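(* Let $K\in\mathbb{R}^{N\times N}$ be a kernel matrix (as specified in the context). Fix $r'\in\mathbb{N}$ and $\epsilon>0$, suppose $\operatorname{tr}(K-[K]_{r'})>0$, and set $$\zeta=(1+\epsilon)\operatorname{tr}(K-[K]_{r'}),\qquad \eta=\operatorname{tr}(K-[K]_{r'})/\operatorname{tr}K.$$ Let $\tilde K$ be the (random) rank-$r$ partial Cholesky approximation of $K$ produced by the randomly pivoted Cholesky algorithm using $r$ columns of $K$, where $r'\leq r<N$ and $r\geq\frac{r'}{\epsilon}+r'\log\frac{1}{\epsilon\eta}$. For $t\in\mathbb{R}$ let $$\alpha_t=d_{\min}-\sqrt{N}t\zeta,\qquad \beta_t=\frac{\sqrt{N}t\zeta}{\alpha_t}\Bigl(1+\frac{\lVert K\rVert}{\alpha_t}\Bigr),$$ and let $t$ and the rank parameter $r$ be chosen such that moreover $$t>1,\qquad\alpha_t>0,\qquad\beta_t<q_{\min}.$$ Then with probability at least $1-1/t$ (over the random choice of sampled columns) one has $\tilde d_{\min}>\alpha_t>0$ and $\tilde q_{\min}>q_{\min}-\beta_t>0$ (so that $\tilde P$ and $\tilde G$ are well defined) and $$\lVert P-\tilde P\rVert_*<(1+\lVert\tilde G\rVert)\Bigl[\frac{1}{\sqrt{q_{\min}-\beta_t}\,\alpha_t}+\frac{\sqrt{N}\operatorname{tr}(K)}{\sqrt{q_{\min}-\beta_t}\,\alpha_t^2}+\frac{\sqrt{N}\operatorname{tr}(K)}{2(q_{\min}-\beta_t)^{3/2}\alpha_t^2}\Bigl(1+\frac{\lVert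 K\rVert}{\alpha_t}\Bigr)\Bigr]t\zeta,$$ where $P=D^{-1}KQ^{-1}KD^{-1}$, $\tilde P=\tilde D^{-1}\tilde K\tilde Q^{-1}\tilde K\tilde D^{-1}$ and $\tilde G=\tilde Q^{-1/2}\tilde K\tilde D^{-1}$.
   Context: Setting. Let $k\colon\mathbb{R}^d\times\mathbb{R}^d\to\mathbb{R}$ be a kernel function that is continuous, bounded and positive semidefinite (symmetric, with positive semidefinite kernel matrices), with $k(u,v)>0$ for all $u,v\in\mathbb{R}^d$. Given samples $u_0,\ldots,u_{N-1}\in\mathbb{R}^d$, $N\in\mathbb{N}$, the kernel matrix is $K\in\mathbb{R}^{N\times N}$ with entries $K_{ij}=k(u_i,u_j)$. Notation. $1_N\in\mathbb{R}^N$ is the vector of ones. Diagonal matrices: $D=\operatorname{diag}(K1_N)$, $Q=\operatorname{diag}(KD^{-1}1_N)$, $\tilde D=\operatorname{diag}(\tilde K1_N)$, $\tilde Q=\operatorname{diag}(\tilde K\tilde D^{-1}1_N)$, with respective diagonal entries $d_i>0$, $q_i>0$, $\tilde d_i$, $\tilde q_i$; $d_{\min},q_{\min},\tilde d_{\min},\tilde q_{\min}$ denote the respective minima over $0\leq i<N$. $\lVert\cdot\rVert$ is the operator (spectral) norm and $\lVert\cdot\rVert_*$ the trace (nuclear) norm. $[K]_{r'}$ is an optimal rank-$r'$ approximation of $K$, obtained from its eigenvalue decomposition by setting the trailing $N-r'$ eigenvalues (in descending order) to zero; thus $\operatorname{tr}(K-[K]_{r'})$ is the sum of the $N-r'$ smallest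 eigenvalues of $K$. Randomly pivoted Cholesky. Pivots (column indices) $s_0,\ldots,s_{r-1}\in\{0,\ldots,N-1\}$ are drawn sequentially. For a set $S$ of indices, the column Nyström approximation is $K(:,S)K(S,S)^+K(:,S)^\top$, where $^+$ is the Moore–Penrose pseudoinverse. Put $\tilde K^{(0)}=0$ and let $\tilde K^{(i)}$ be the column Nyström approximation for $S=\{s_0,\ldots,s_{i-1}\}$. With $\rho^{(i)}=\operatorname{diag}(K-\tilde K^{(i)})$, the pivot $s_i$ is drawn, conditionally on the previous pivots, with probability $\mathbb{P}\{s_i=j\}=\rho^{(i)}(j)/\sum_{l=0}^{N-1}\rho^{(i)}(l)$ (if $\rho^{(i)}=0$ the algorithm stops with $\tilde K=K$). The output is $\tilde K=\tilde K^{(r)}$, which can be written $\tilde K=FF^\top$ with $F\in\mathbb{R}^{N\times r}$, and satisfies $K\geq\tilde K\geq 0$ in the positive semidefinite order. Known result that may be used (Chen et al., cited by the paper): for a positive semidefinite matrix $K$ and $r,r',\epsilon,\zeta,\eta$ with $r\geq r'$ and $r\geq\frac{r'}{\epsilon}+r'\log\frac{1}{\epsilon\eta}$, the output of randomly pivoted Cholesky satisfies $\mathbb{E}\operatorname{tr}(K-\tilde K)\leq\zeta$. *)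

(* Defs.v *)
From mathcomp Require Export all_boot all_order all_algebra.
From mathcomp Require Export polyrcf.
From mathcomp Require Export all_classical all_reals all_analysis.
Set Implicit Arguments.
Unset Strict Implicit.
Unset Printing Implicit Defensive.
Export Order.TTheory GRing.Theory Num.Theory.
Export numFieldNormedType.Exports.
Local Open Scope classical_set_scope.
Local Open Scope ring_scope.

Definition psdmx (R : realType) n (A : 'M[R]_n) : Prop :=
  A^T = A /\ forall x : 'cV[R]_n, 0 <= (x^T *m A *m x) 0 0.

Definition kernel_mx (R : realType) (U : Type) (k : U -> U -> R) n
    (u : 'I_n -> U) : 'M[R]_n :=
  \matrix_(i, j) k (u i) (u j).

Definition psd_kernel (R : realType) (U : Type) (k : U -> U -> R) : Prop :=
  (forall x y, k x y = k y x) /\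
  forall n (u : 'I_n -> U), psdmx (kernel_mx k u).

(* 'rV[R]_d and the product carry the product topology, i.e. the usual one of
   R^d x R^d. *)
Definition admissible_kernel (R : realType) d
    (k : 'rV[R]_d -> 'rV[R]_d -> R) : Prop :=
  [/\ continuous (fun xy : 'rV[R]_d * 'rV[R]_d => k xy.1 xy.2),
      exists M : R, forall x y, `|k x y| <= M,
      psd_kernel k &
      forall x y, 0 < k x y].

Definition l2norm (R : realType) n (x : 'cV[R]_n) : R :=
  Num.sqrt (\sum_i x i 0 ^+ 2).

Definition opnorm (R : realType) m n (A : 'M[R]_(m, n)) : R :=
  sup [set l2norm (A *m x) | x in [set x : 'cV[R]_n | l2norm x <= 1]].

(* Sum of the singular values: square roots of the eigenvalues of A^T A, each
   counted with its multiplicity as a root of the characteristic polynomial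
   ([rootsR p] lists the distinct real roots of p). *)
Definition nuclear_norm (R : realType) m n (A : 'M[R]_(m, n)) : R :=
  let p := char_poly (A^T *m A) in
  \sum_(x <- rootsR p) Num.sqrt x *+ mup x p.

(* B arises from an orthogonal eigendecomposition of the symmetric matrix A,
   eigenvalues in descending order, by zeroing all but the first m of them. The
   matrix B need not be unique when eigenvalues are repeated. *)
Definition eig_truncation (R : realType) n (A : 'M[R]_n) (m : nat)
    (B : 'M[R]_n) : Prop :=
  exists (V : 'M[R]_n) (lam : 'rV[R]_n),
  [/\ V *m V^T = 1%:M,
      forall i j : 'I_n, (i <= j)%N -> lam 0 j <= lam 0 i,
      A = V *m diag_mx lam *m V^T &
      B = V *m diag_mx (\row_i (if (i < m)%N then lam 0 i else 0)) *m V^T].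

Definition is_moore_penrose (R : realType) m n (A : 'M[R]_(m, n))
    (X : 'M[R]_(n, m)) : Prop :=
  [/\ A *m X *m A = A, X *m A *m X = X,
      (A *m X)^T = A *m X & (X *m A)^T = X *m A].

(* The Moore-Penrose pseudoinverse; the library's [pinvmx] is only a
   generalized inverse. *)
Definition mp_pinv (R : realType) m n (A : 'M[R]_(m, n)) : 'M[R]_(n, m) :=
  xget 0 [set X | is_moore_penrose A X].

Definition nystrom (R : realType) n (K : 'M[R]_n) (S : {set 'I_n}) : 'M[R]_n :=
  let ix (a : 'I_#|S|) : 'I_n := enum_val a in
  colsub ix K *m mp_pinv (mxsub ix ix K) *m (colsub ix K)^T.

(* A run of the algorithm is a function h : 'I_r -> option 'I_n giving the
   pivots s_0, ..., s_(r-1), with None once the algorithm has stopped.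
   [selected h i] is the set {s_0, ..., s_(i-1)}. *)
Definition selected n r (h : 'I_r -> option 'I_n) (i : nat) : {set 'I_n} :=
  [set j | [exists l : 'I_r, (l < i)%N && (h l == Some j)]]%SET.

Definition residual_diag (R : realType) n (K : 'M[R]_n) (S : {set 'I_n}) :
    'rV[R]_n :=
  \row_j (K - nystrom K S) j j.

(* Conditional probability that the next step is o when S has been selected. *)
Definition pivot_prob (R : realType) n (K : 'M[R]_n) (S : {set 'I_n})
    (o : option 'I_n) : R :=
  let rho := residual_diag K S in
  if rho == 0 then (o == None)%:R
  else if o is Some j then rho 0 j / \sum_l rho 0 l else 0.

(* s_0, ..., s_(r-1) are random pivots of randomly pivoted Cholesky: the law of
   s_i given s_0, ..., s_(i-1) is [pivot_prob]. The conditional law is written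
   as a product, P(A and B) = P(A) * P(B | A), so that pasts of probability zero
   need no separate treatment. *)
Definition rp_cholesky_pivots (R : realType) (disp : measure_display)
    (T : measurableType disp) (Pr : probability T R) n (K : 'M[R]_n) r
    (s : 'I_r -> T -> option 'I_n) : Prop :=
  (forall i o, measurable (s i @^-1` [set o])) /\
  forall (h : 'I_r -> option 'I_n) (i : 'I_r),
    Pr [set w | forall l : 'I_r, (l <= i)%N -> s l w = h l] =
    (Pr [set w | forall l : 'I_r, (l < i)%N -> s l w = h l] *
     (pivot_prob K (selected h i) (h i))%:E)%E.

Definition rp_cholesky_output (R : realType) (T : Type) n (K : 'M[R]_n) r
    (s : 'I_r -> T -> option 'I_n) (w : T) : 'M[R]_n :=
  nystrom K (selected (fun l => s l w) r).

(* D = diag(K 1), Q = diag(K D^-1 1). Note that [invmx] is the identity on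
   singular matrices. *)
Definition dvec (R : realType) n (K : 'M[R]_n) : 'cV[R]_n := K *m const_mx 1.
Definition Dmx (R : realType) n (K : 'M[R]_n) : 'M[R]_n := diag_mx (dvec K)^T.
Definition qvec (R : realType) n (K : 'M[R]_n) : 'cV[R]_n :=
  K *m invmx (Dmx K) *m const_mx 1.
Definition Qmx (R : realType) n (K : 'M[R]_n) : 'M[R]_n := diag_mx (qvec K)^T.

Definition Pmx (R : realType) n (K : 'M[R]_n) : 'M[R]_n :=
  invmx (Dmx K) *m K *m invmx (Qmx K) *m K *m invmx (Dmx K).

(* G = Q^(-1/2) K D^-1 *)
Definition Gmx (R : realType) n (K : 'M[R]_n) : 'M[R]_n :=
  diag_mx (\row_i (Num.sqrt (qvec K i 0))^-1) *m K *m invmx (Dmx K).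

(* For n > 0 the infimum is attained: this is the minimum of the entries. *)
Definition vmin (R : realType) n (x : 'cV[R]_n) : R :=
  inf (range (fun i => x i 0)).

(* Main.v *)
(* The randomly pivoted Cholesky residual A satisfies
     E[v' A_next v | A] <= v' A v - |A v|^2 / tr A.
   Summing over the leading r' eigenvectors of K, the expected trace a of A
   on their span obeys a_next <= a - a^2 / (r' (a + b)), where b = tr (K - [K]_r')
   dominates the trace on the complementary span since A <= K. Comparing with the
   corresponding differential equation gives E tr A <= (1 + eps) b after r steps,
   and Markov's inequality gives tr (K - Kt) < t zeta with the required probability.

   The rest is deterministic. Writing P = G' G, one has
     P - Pt = G' (G - Gt) + (G - Gt)' Gt
   with |G| <= 1, and G - Gt splits into three terms, each a product of diagonal
   matrices with one of the positive semidefinite matrices K - Kt and K. The nuclear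
   norm is tested against the sign of P - Pt, and |tr (B E)| <= |B| tr E for E
   positive semidefinite. *)
Require Import Defs.
From mathcomp Require Import ring lra complex.
Set Implicit Arguments.
Unset Strict Implicit.
Unset Printing Implicit Defensive.
Local Open Scope classical_set_scope.
Local Open Scope ring_scope.

(** * Euclidean norm and operator norm bounds *)

Section EuclideanSpace.
Context {R : realType}.

Definition dot n (x y : 'cV[R]_n) : R := (x^T *m y) 0 0.

Lemma dotE n (x y : 'cV[R]_n) : dot x y = \sum_i x i 0 * y i 0.
Proof. by rewrite /dot mxE; apply: eq_bigr => i _; rewrite mxE. Qed.

Lemma dotC n (x y : 'cV[R]_n) : dot x y = dot y x.
Proof. by rewrite !dotE; apply: eq_bigr => i _; rewrite mulrC. Qed.

Lemma dotDr n (x y z : 'cV[R]_n) : dot x (y + z) = dot x y + dot x z.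
Proof. by rewrite /dot mulmxDr mxE. Qed.

Lemma dotDl n (x y z : 'cV[R]_n) : dot (x + y) z = dot x z + dot y z.
Proof. by rewrite ![dot _ z]dotC dotDr. Qed.

Lemma dotZr n c (x y : 'cV[R]_n) : dot x (c *: y) = c * dot x y.
Proof. by rewrite /dot -scalemxAr mxE. Qed.

Lemma dotZl n c (x y : 'cV[R]_n) : dot (c *: x) y = c * dot x y.
Proof. by rewrite dotC dotZr dotC. Qed.

Lemma dotNr n (x y : 'cV[R]_n) : dot x (- y) = - dot x y.
Proof. by rewrite -scaleN1r dotZr mulN1r. Qed.

Lemma dotNl n (x y : 'cV[R]_n) : dot (- x) y = - dot x y.
Proof. by rewrite dotC dotNr dotC. Qed.

Lemma dotBr n (x y z : 'cV[R]_n) : dot x (y - z) = dot x y - dot x z.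
Proof. by rewrite dotDr dotNr. Qed.

Lemma dotBl n (x y z : 'cV[R]_n) : dot (x - y) z = dot x z - dot y z.
Proof. by rewrite dotDl dotNl. Qed.

Lemma dot0r n (x : 'cV[R]_n) : dot x 0 = 0.
Proof. by rewrite /dot mulmx0 mxE. Qed.

Lemma dot_trmx m n (A : 'M[R]_(m, n)) x y : dot (A *m x) y = dot x (A^T *m y).
Proof. by rewrite /dot trmx_mul mulmxA. Qed.

Lemma dot_delta n (x : 'cV[R]_n) j : dot (delta_mx j 0) x = x j 0.
Proof.
rewrite dotE (bigD1 j) //= big1 => [|i /negPf nij].
  by rewrite mxE !eqxx mul1r addr0.
by rewrite mxE nij mul0r.
Qed.

Lemma dotxx_ge0 n (x : 'cV[R]_n) : 0 <= dot x x.
Proof. by rewrite dotE sumr_ge0 // => i _; rewrite -expr2 sqr_ge0. Qed.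

Lemma dotxx_eq0 n (x : 'cV[R]_n) : dot x x = 0 -> x = 0.
Proof.
rewrite dotE => /eqP; rewrite psumr_eq0; last by move=> i _; rewrite -expr2 sqr_ge0.
move=> /allP h; apply/colP => i; rewrite mxE; apply/eqP.
by have /= := h i (mem_index_enum _); rewrite mulf_eq0 orbb.
Qed.

(** The square length of [dot y y *: x - dot x y *: y] equals [dot y y] times the defect of the
    inequality. *)
Lemma cauchy_schwarz n (x y : 'cV[R]_n) : dot x y ^+ 2 <= dot x x * dot y y.
Proof.
have [y0|yn0] := eqVneq (dot y y) 0.
  by rewrite (dotxx_eq0 y0) !dot0r mulr0 expr0n.
have yp : 0 < dot y y by rewrite lt_def yn0 dotxx_ge0.
have := dotxx_ge0 (dot y y *: x - dot x y *: y).
rewrite !(dotBl, dotBr, dotZl, dotZr) (dotC y x) => h.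
rewrite -subr_ge0 -(pmulr_rge0 _ yp); apply: le_trans h _.
by rewrite le_eqVlt; apply/orP; left; apply/eqP; ring.
Qed.

Lemma l2normE n (x : 'cV[R]_n) : l2norm x = Num.sqrt (dot x x).
Proof. by rewrite /l2norm dotE. Qed.

Lemma l2norm_ge0 n (x : 'cV[R]_n) : 0 <= l2norm x.
Proof. exact: sqrtr_ge0. Qed.

Lemma l2norm_sqr n (x : 'cV[R]_n) : l2norm x ^+ 2 = dot x x.
Proof. by rewrite l2normE sqr_sqrtr ?dotxx_ge0. Qed.

Lemma l2norm_leP n (x : 'cV[R]_n) c : 0 <= c -> (l2norm x <= c) = (dot x x <= c ^+ 2).
Proof. by move=> c0; rewrite -l2norm_sqr ler_pXn2r ?nnegrE ?l2norm_ge0. Qed.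

Lemma dot_le n (x y : 'cV[R]_n) : `|dot x y| <= l2norm x * l2norm y.
Proof.
rewrite -(ler_pXn2r (n := 2)) ?nnegrE ?mulr_ge0 ?l2norm_ge0 //.
by rewrite real_normK ?num_real // exprMn !l2norm_sqr cauchy_schwarz.
Qed.

Lemma l2normZ n c (x : 'cV[R]_n) : l2norm (c *: x) = `|c| * l2norm x.
Proof.
by rewrite !l2normE dotZl dotZr mulrA -expr2 sqrtrM ?sqr_ge0 // sqrtr_sqr.
Qed.

Lemma l2norm0 n : l2norm (0 : 'cV[R]_n) = 0.
Proof. by rewrite -(scale0r 0) l2normZ normr0 mul0r. Qed.

Lemma l2norm_eq0 n (x : 'cV[R]_n) : l2norm x = 0 -> x = 0.
Proof. by move=> h; apply: dotxx_eq0; rewrite -l2norm_sqr h expr0n. Qed.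

Lemma l2normD n (x y : 'cV[R]_n) : l2norm (x + y) <= l2norm x + l2norm y.
Proof.
rewrite l2norm_leP ?addr_ge0 ?l2norm_ge0 // dotDl !dotDr (dotC y x).
have := ler_norm (dot x y); have := dot_le x y.
by rewrite sqrrD !l2norm_sqr -mulr_natl; lra.
Qed.

Lemma l2norm_entry n (x : 'cV[R]_n) i : `|x i 0| <= l2norm x.
Proof.
rewrite -(ler_pXn2r (n := 2)) ?nnegrE ?l2norm_ge0 //.
rewrite real_normK ?num_real // l2norm_sqr dotE (bigD1 i) //= expr2 lerDl.
by rewrite sumr_ge0 // => j _; rewrite -expr2 sqr_ge0.
Qed.

Lemma l2norm_const1 n : l2norm (const_mx 1 : 'cV[R]_n) = Num.sqrt n%:R.
Proof.
rewrite l2normE dotE (eq_bigr (fun=> 1)) ?sumr_const ?card_ord //.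
by move=> i _; rewrite mxE mulr1.
Qed.

(** Pointwise upper bounds on the operator norm add and multiply without any handling of the
    supremum in [opnorm]; [opnorm_opbound] links the two. *)
Definition opbound m n (A : 'M[R]_(m, n)) (c : R) :=
  forall x, l2norm (A *m x) <= c * l2norm x.

Lemma opboundM m n p (A : 'M[R]_(m, n)) (B : 'M[R]_(n, p)) a b : 0 <= a ->
  opbound A a -> opbound B b -> opbound (A *m B) (a * b).
Proof.
move=> a0 hA hB x; rewrite -mulmxA (le_trans (hA _)) // -mulrA.
by rewrite ler_wpM2l.
Qed.

Lemma opboundD m n (A B : 'M[R]_(m, n)) a b :
  opbound A a -> opbound B b -> opbound (A + B) (a + b).
Proof.
by move=> hA hB x; rewrite mulmxDl (le_trans (l2normD _ _)) // mulrDl lerD.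
Qed.

Lemma opbound_dot m n (A : 'M[R]_(m, n)) c x y :
  opbound A c -> `|dot y (A *m x)| <= c * l2norm y * l2norm x.
Proof.
move=> hA; apply: le_trans (dot_le _ _) _.
by rewrite -mulrA mulrCA ler_wpM2l ?l2norm_ge0.
Qed.

(** Test with y = A x and cancel one factor |A x|. *)
Lemma dot_opbound m n (A : 'M[R]_(m, n)) c : 0 <= c ->
  (forall x y, dot y (A *m x) <= c * l2norm y * l2norm x) -> opbound A c.
Proof.
move=> c0 h x; have := h x (A *m x); rewrite -l2norm_sqr.
have [->|n0] := eqVneq (l2norm (A *m x)) 0; first by rewrite mulr_ge0 ?l2norm_ge0.
by rewrite expr2 mulrAC ler_pM2r // lt_def n0 l2norm_ge0.
Qed.

Lemma opbound_trmx m n (A : 'M[R]_(m, n)) c :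
  0 <= c -> opbound A c -> opbound A^T c.
Proof.
move=> c0 hA; apply: dot_opbound => // x y.
rewrite dotC dot_trmx trmxK mulrAC.
exact: le_trans (ler_norm _) (opbound_dot _ _ hA).
Qed.

Lemma opbound_diag n (a : 'rV[R]_n) c : 0 <= c ->
  (forall i, `|a 0 i| <= c) -> opbound (diag_mx a) c.
Proof.
move=> c0 h x; rewrite l2norm_leP ?mulr_ge0 ?l2norm_ge0 //.
rewrite exprMn l2norm_sqr !dotE mulr_sumr ler_sum // => i _.
rewrite mul_diag_mx mxE -!expr2 exprMn ler_wpM2r ?sqr_ge0 //.
by rewrite -(real_normK (num_real _)) ler_pXn2r ?nnegrE.
Qed.

Lemma opbound_outer m n (x : 'cV[R]_m) (y : 'cV[R]_n) :
  opbound (x *m y^T) (l2norm x * l2norm y).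
Proof.
move=> z; have -> : x *m y^T *m z = dot y z *: x.
  by rewrite -mulmxA [y^T *m z]mx11_scalar mul_mx_scalar /dot.
by rewrite l2normZ -mulrA mulrC ler_wpM2l ?l2norm_ge0 // dot_le.
Qed.

Lemma opbound_orthogonal m n (V : 'M[R]_(m, n)) : V^T *m V = 1%:M -> opbound V 1.
Proof.
by move=> hV x; rewrite mul1r !l2normE dot_trmx mulmxA hV mul1mx.
Qed.

(** Cauchy-Schwarz row by row. This crude bound serves to show that the supremum defining [opnorm]
    is finite. *)
Lemma opbound_frobenius m n (A : 'M[R]_(m, n)) :
  opbound A (Num.sqrt (\sum_i \sum_j A i j ^+ 2)).
Proof.
move=> x; rewrite l2norm_leP ?mulr_ge0 ?l2norm_ge0 ?sqrtr_ge0 //.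
rewrite exprMn l2norm_sqr sqr_sqrtr; last by do 2?apply: sumr_ge0 => ? _; exact: sqr_ge0.
rewrite dotE mulr_suml ler_sum // => i _.
have -> : (A *m x) i 0 = dot (row i A)^T x.
  by rewrite /dot trmxK -row_mul [RHS]mxE.
rewrite -expr2 (le_trans (cauchy_schwarz _ _)) // ler_wpM2r ?dotxx_ge0 //.
by rewrite dotE le_eqVlt; apply/orP; left; apply/eqP/eq_bigr => j _; rewrite !mxE expr2.
Qed.

Lemma opnorm_has_sup m n (A : 'M[R]_(m, n)) :
  has_sup [set l2norm (A *m x) | x in [set x : 'cV[R]_n | l2norm x <= 1]].
Proof.
split.
  exists (l2norm (A *m 0)), 0 => //=.
  by rewrite l2norm0.
exists (Num.sqrt (\sum_i \sum_j A i j ^+ 2)) => _ [x /= x1 <-].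
by rewrite (le_trans (opbound_frobenius _ _)) // ler_piMr // sqrtr_ge0.
Qed.

Lemma opnorm_opbound m n (A : 'M[R]_(m, n)) : opbound A (opnorm A).
Proof.
move=> x; have [x0|n0] := eqVneq (l2norm x) 0.
  by rewrite (l2norm_eq0 x0) mulmx0 !l2norm0 mulr0.
have xp : 0 < l2norm x by rewrite lt_def n0 l2norm_ge0.
rewrite -ler_pdivrMr //; have -> : l2norm (A *m x) / l2norm x =
    l2norm (A *m ((l2norm x)^-1 *: x)).
  by rewrite -scalemxAr l2normZ ger0_norm ?invr_ge0 ?ltW // mulrC.
refine (sup_upper_bound (opnorm_has_sup A) _).
exists ((l2norm x)^-1 *: x) => //=.
by rewrite l2normZ ger0_norm ?invr_ge0 ?l2norm_ge0 // mulVf.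
Qed.

Lemma opnorm_ge0 m n (A : 'M[R]_(m, n)) : 0 <= opnorm A.
Proof.
apply: le_trans (l2norm_ge0 (A *m 0)) _.
refine (sup_upper_bound (opnorm_has_sup A) _).
by exists 0 => //=; rewrite l2norm0.
Qed.

End EuclideanSpace.

(** * Spectral theorem for real symmetric matrices *)

Section Spectral.
Context {R : realType}.

(** A complex eigenvector w exists because the characteristic polynomial has a complex root.
    Symmetry makes the eigenvalue real, so the real and imaginary parts of w satisfy the same
    eigenvector equation, and one of them is nonzero. *)
Lemma sym_eigenvector n (A : 'M[R]_(1 + n)) : A^T = A ->
  exists (v : 'cV[R]_(1 + n)) (a : R), dot v v = 1 /\ A *m v = a *: v.
Proof.
move=> symA; set Ac := map_mx (real_complex R) A.
have [z rz] : exists z, root (char_poly Ac) z.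
  by apply/closed_rootP; rewrite size_char_poly.
move: rz; rewrite -eigenvalue_root_char => /eigenvalueP [w wA w0].
pose x : 'cV[R]_(1 + n) := \col_i complex.Re (w 0 i).
pose y : 'cV[R]_(1 + n) := \col_i complex.Im (w 0 i).
have wE i : w 0 i = (x i 0 +i* y i 0)%C by rewrite !mxE; case: (w 0 i).
have AxE i : (A *m x) i 0 = complex.Re z * x i 0 - complex.Im z * y i 0.
  have := congr1 (fun M : 'rV_ _ => complex.Re (M 0 i)) wA.
  rewrite !mxE wE; case: z {wA} => a b /= <-.
  rewrite (raddf_sum (@complex.Re R : Rcomplex R -> R)); apply: eq_bigr => j _.
  by rewrite !mxE -[A in RHS]symA mxE; case: (w 0 j) => p q /=; ring.
have AyE i : (A *m y) i 0 = complex.Im z * x i 0 + complex.Re z * y i 0.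
  have := congr1 (fun M : 'rV_ _ => complex.Im (M 0 i)) wA.
  rewrite !mxE wE; case: z {wA AxE} => a b /=; rewrite [X in _ = X]addrC => <-.
  rewrite (raddf_sum (@complex.Im R : Rcomplex R -> R)); apply: eq_bigr => j _.
  by rewrite !mxE -[A in RHS]symA mxE; case: (w 0 j) => p q /=; ring.
have Ax : A *m x = complex.Re z *: x - complex.Im z *: y.
  by apply/colP => i; rewrite AxE !mxE.
have Ay : A *m y = complex.Im z *: x + complex.Re z *: y.
  by apply/colP => i; rewrite AyE !mxE.
have xy0 : dot x x + dot y y != 0.
  apply: contra w0; rewrite paddr_eq0 ?dotxx_ge0 // => /andP[/eqP x0 /eqP y0].
  apply/eqP/rowP => i.
  by rewrite wE (dotxx_eq0 x0) (dotxx_eq0 y0) !mxE.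
(* The two sides of <A x, y> = <x, A y> differ by Im z times |x|^2 + |y|^2. *)
have z0 : complex.Im z = 0.
  have := dot_trmx A x y; rewrite symA Ax Ay dotBl dotDr !dotZl !dotZr => h.
  have : complex.Im z * (dot x x + dot y y) = 0 by rewrite mulrDr; lra.
  by move/eqP; rewrite mulf_eq0 (negPf xy0) orbF => /eqP.
have [v v0 Av] : exists2 v, dot v v != 0 & A *m v = complex.Re z *: v.
  have [x0|xn0] := eqVneq (dot x x) 0; last first.
    by exists x; rewrite // Ax z0 scale0r subr0.
  exists y; last by rewrite Ay z0 scale0r add0r.
  by move: xy0; rewrite x0 add0r.
have lv0 : l2norm v != 0.
  by apply: contra v0 => /eqP/l2norm_eq0 ->; rewrite dot0r.
exists ((l2norm v)^-1 *: v), (complex.Re z); split; last first.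
  by rewrite -scalemxAr Av !scalerA mulrC.
by rewrite dotZl dotZr -l2norm_sqr; field.
Qed.

(** H is the reflection in the hyperplane orthogonal to w = v - e, or the identity when v = e. *)
Lemma householder n (v : 'cV[R]_n) (i : 'I_n) : dot v v = 1 ->
  exists H : 'M[R]_n, [/\ H^T = H, H *m H = 1%:M & H *m delta_mx i 0 = v].
Proof.
move=> vv; pose e : 'cV[R]_n := delta_mx i 0; pose w := v - e.
have ee : dot e e = 1 by rewrite dot_delta mxE !eqxx.
have wE (x : 'cV[R]_n) : w *m w^T *m x = dot w x *: w.
  by rewrite -mulmxA [w^T *m x]mx11_scalar mul_mx_scalar.
have [w0|wn0] := eqVneq (dot w w) 0.
  exists 1%:M; rewrite trmx1 mul1mx; split=> //; rewrite mul1mx.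
  by have /eqP := dotxx_eq0 w0; rewrite subr_eq0 => /eqP ->.
pose c := 2 / dot w w.
exists (1%:M - c *: (w *m w^T)); split.
- by rewrite linearB /= trmx1 linearZ /= trmx_mul trmxK.
- have PP : w *m w^T *m (w *m w^T) = dot w w *: (w *m w^T).
    by rewrite mulmxA wE scalemxAl.
  rewrite mulmxBl mul1mx mulmxBr mulmx1 -scalemxAl -scalemxAr PP.
  apply/matrixP => k l; rewrite !mxE /=.
  by rewrite /c; field.
rewrite mulmxBl mul1mx -scalemxAl wE scalerA -/e.
(* Since v and e are both unit vectors, |w|^2 = -2 <w, e>. *)
have -> : c * dot w e = -1; last by rewrite scaleN1r opprK addrC subrK.
have dwe : dot w e = dot v e - 1 by rewrite /w dotBl ee.
have dww : dot w w = - 2 * (dot v e - 1).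
  by rewrite {1}/w dotBl /w !dotBr vv ee (dotC e v); ring.
rewrite /c dwe dww; field; apply: contra wn0; rewrite dww => /eqP ->.
by rewrite mulr0.
Qed.

(** Induction on the dimension: conjugating by a reflection that sends the first basis vector to an
    eigenvector makes A block diagonal, and the induction hypothesis diagonalizes the lower
    block. *)
Lemma sym_spectral n (A : 'M[R]_n) : A^T = A ->
  exists (V : 'M[R]_n) (a : 'rV[R]_n),
    V *m V^T = 1%:M /\ A = V *m diag_mx a *m V^T.
Proof.
elim: n A => [|n IH]; last rewrite -[n.+1]/(1 + n)%N; move=> A symA.
  by exists 1%:M, 0; split; apply/matrixP => -[].
have [v [a [vv Av]]] := sym_eigenvector symA.
have [H [symH HH He]] := householder (ord0 : 'I_(1 + n)) vv.
(* B must not be a local definition: mxE would see through it. *)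
have [B defB] : exists B : 'M[R]_(1 + n), B = H *m A *m H by exists (H *m A *m H).
have symB : B^T = B by rewrite defB !trmx_mul symH symA mulmxA.
have Be : B *m delta_mx (ord0 : 'I_(1 + n)) 0 =
    a *: (delta_mx (ord0 : 'I_(1 + n)) 0 : 'cV[R]_(1 + n)).
  rewrite defB -(mulmxA (H *m A) H) He -(mulmxA H A) Av -scalemxAr.
  by rewrite -[X in _ *: (H *m X)]He mulmxA HH mul1mx.
have colB i : B i (ord0 : 'I_(1 + n)) = (i == ord0)%:R * a.
  have := congr1 (fun M : 'cV_ _ => M i 0) Be.
  by rewrite -colE !mxE andbT mulrC.
have BE : B = block_mx a%:M 0 0 (drsubmx B).
  rewrite -[LHS]submxK; congr block_mx.
  - by apply/matrixP => i j; rewrite !mxE !ord1 lshift0 colB eqxx mul1r.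
  - apply/matrixP => i j; rewrite -symB !mxE !ord1 lshift0 colB.
    by rewrite (_ : _ == _ = false) ?mul0r // -(inj_eq val_inj).
  - apply/matrixP => i j; rewrite !mxE !ord1 lshift0 colB.
    by rewrite (_ : _ == _ = false) ?mul0r // -(inj_eq val_inj).
have [V [b [VV bE]]] := IH (drsubmx B) (etrans (trmx_drsub B) (congr1 drsubmx symB)).
pose W : 'M[R]_(1 + n) := block_mx (1%:M : 'M[R]_1) 0 0 V.
pose c : 'rV[R]_(1 + n) := row_mx (a%:M : 'M[R]_1) b.
have WW : W *m W^T = 1%:M.
  rewrite /W (tr_block_mx (1%:M : 'M[R]_1)) (mulmx_block (1%:M : 'M[R]_1)).
  by rewrite !(mul0mx, mulmx0, trmx0, trmx1, mul1mx, addr0, add0r) VV -scalar_mx_block.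
have BW : B = W *m diag_mx c *m W^T.
  rewrite BE /W /c (tr_block_mx (1%:M : 'M[R]_1)) (diag_mx_row (a%:M : 'M[R]_1) b).
  rewrite !(mulmx_block (1%:M : 'M[R]_1), mulmx_block (1%:M *m _ + _)).
  rewrite !(mul0mx, mulmx0, trmx0, trmx1, mul1mx, mulmx1, addr0, add0r) -bE.
  by congr block_mx; apply/matrixP => i j; rewrite !mxE !ord1 eqxx.
exists (H *m W), c; split.
  by rewrite trmx_mul symH mulmxA -(mulmxA H) WW mulmx1.
have -> : A = H *m B *m H.
  by rewrite defB !mulmxA HH mul1mx -mulmxA HH mulmx1.
by rewrite BW trmx_mul symH !mulmxA.
Qed.

End Spectral.

(** * Trace duality and the nuclear norm *)

Section TraceDuality.
Context {R : realType}.

Lemma psdmx_dot n (A : 'M[R]_n) x : psdmx A -> 0 <= dot x (A *m x).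
Proof. by case=> _ /(_ x); rewrite /dot mulmxA. Qed.

Lemma mxE_dot n (A : 'M[R]_n) i j :
  A i j = dot (delta_mx i 0) (A *m delta_mx j 0).
Proof. by rewrite dot_delta -colE mxE. Qed.

Lemma psdmx_diag_ge0 n (A : 'M[R]_n) i : psdmx A -> 0 <= A i i.
Proof. by move=> /psdmx_dot psdA; rewrite mxE_dot. Qed.

Lemma psdmx_trace_ge0 n (A : 'M[R]_n) : psdmx A -> 0 <= \tr A.
Proof. by move=> psdA; apply: sumr_ge0 => i _; exact: psdmx_diag_ge0. Qed.

Lemma conjmxE m n (V : 'M[R]_(n, m)) (B : 'M[R]_n) i j :
  (V^T *m B *m V) i j = dot (col i V) (B *m col j V).
Proof.
by rewrite /dot tr_col colE !mulmxA -!row_mul -colE [in RHS]mxE [in RHS]mxE.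
Qed.

Lemma orthogonal_col n (V : 'M[R]_n) i : V *m V^T = 1%:M ->
  dot (col i V) (col i V) = 1.
Proof.
move=> /mulmx1C VV; rewrite -[X in dot _ X]mul1mx -conjmxE mulmx1 VV.
by rewrite mxE eqxx.
Qed.

Lemma mxtrace_orthogonal n (V A : 'M[R]_n) : V *m V^T = 1%:M ->
  \tr A = \sum_i dot (col i V) (A *m col i V).
Proof.
move=> VV; rewrite -[A in LHS]mulmx1 -VV mulmxA mxtrace_mulC mulmxA.
by apply: eq_bigr => i _; rewrite conjmxE.
Qed.

Lemma spectral_eig n (V : 'M[R]_n) (a : 'rV[R]_n) i : V *m V^T = 1%:M ->
  V *m diag_mx a *m V^T *m col i V = a 0 i *: col i V.
Proof.
move=> /mulmx1C VV; rewrite colE -2!mulmxA [V^T *m _]mulmxA VV mul1mx.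
rewrite scalemxAr; congr (_ *m _); apply/colP => j; rewrite mul_diag_mx !mxE.
by case: eqVneq => [->|]; rewrite // !mulr0.
Qed.

(** In an orthonormal eigenbasis of E the trace is a sum of <v, B v>, each at most c in absolute
    value, weighted by the nonnegative eigenvalues of E. *)
Lemma mxtrace_psd_le n (B E : 'M[R]_n) c : psdmx E -> 0 <= c -> opbound B c ->
  `|\tr (B *m E)| <= c * \tr E.
Proof.
move=> psdE c0 hB; have [V [a [VV Ea]]] := sym_spectral psdE.1.
have Ecol i : E *m col i V = a 0 i *: col i V by rewrite {1}Ea spectral_eig.
have a0 i : 0 <= a 0 i.
  have := psdmx_dot (col i V) psdE.
  by rewrite Ecol dotZr orthogonal_col // mulr1.
rewrite !(mxtrace_orthogonal _ VV) mulr_sumr.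
apply: le_trans (ler_norm_sum _ _ _) _; apply: ler_sum => i _.
rewrite -mulmxA Ecol -scalemxAr !dotZr orthogonal_col // mulr1 normrM.
rewrite ger0_norm // mulrC ler_wpM2r //.
apply: le_trans (opbound_dot _ _ hB) _.
by rewrite l2normE orthogonal_col // sqrtr1 !mulr1.
Qed.

(** Trace duality applied to the rank-one matrix x y^T. *)
Lemma psdmx_opbound n (E : 'M[R]_n) : psdmx E -> opbound E (\tr E).
Proof.
move=> psdE; apply: dot_opbound => [|x y]; first exact: psdmx_trace_ge0.
have -> : dot y (E *m x) = \tr (x *m y^T *m E).
  by rewrite /dot -mulmxA mxtrace_mulC mulmxA /mxtrace big_ord1.
rewrite -mulrA mulrC (mulrC (l2norm y)); apply: le_trans (ler_norm _) _.
by apply: mxtrace_psd_le (opbound_outer _ _); rewrite ?mulr_ge0 ?l2norm_ge0.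
Qed.

Lemma char_poly_orthogonal n (V B : 'M[R]_n) : V *m V^T = 1%:M ->
  char_poly (V *m B *m V^T) = char_poly B.
Proof.
move=> VV; rewrite /char_poly /char_poly_mx.
have PP : map_mx polyC V *m map_mx polyC V^T = 1%:M.
  by rewrite -map_mxM VV map_mx1.
have -> : 'X%:M - map_mx polyC (V *m B *m V^T) =
   map_mx polyC V *m ('X%:M - map_mx polyC B) *m map_mx polyC V^T.
  rewrite mulmxBr mulmxBl !map_mxM mul_mx_scalar -scalemxAl PP.
  by rewrite scalemx1.
by rewrite !det_mulmx mulrAC -det_mulmx PP det1 mul1r.
Qed.

Lemma char_poly_diag n (a : 'rV[R]_n) :
  char_poly (diag_mx a) = \prod_i ('X - (a 0 i)%:P).
Proof.
rewrite char_poly_trig ?diag_mx_is_trig //.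
by apply: eq_bigr => i _; rewrite mxE eqxx mulr1n.
Qed.

(** Turns the sum over distinct roots with multiplicities, as in [nuclear_norm], into a sum over
    eigenvalues listed with repetition. *)
Lemma sum_rootsR_prod (f : R -> R) (s : seq R) :
  let p := \prod_(x <- s) ('X - x%:P) in
  \sum_(x <- rootsR p) f x *+ mup x p = \sum_(x <- s) f x.
Proof.
move=> p; have p0 : p != 0 by rewrite monic_neq0 ?monic_prod_XsubC.
have us : perm_eq (rootsR p) (undup s).
  apply: uniq_perm; rewrite ?undup_uniq ?uniq_roots // => x.
  by rewrite mem_undup -(roots_on_rootsR p0) in_itv /= root_prod_XsubC.
rewrite (perm_big _ us) -[RHS](big_undup_iterop_count _ s xpredT) /=.
apply: eq_bigr => x _; rewrite mu_prod_XsubC Monoid.iteropE iter_addr addr0.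
by congr (_ *+ _); exact: eq_count.
Qed.

(* W is the sign of A in the functional calculus. *)
Lemma nuclear_norm_sym n (A : 'M[R]_n) : A^T = A ->
  exists W : 'M[R]_n, [/\ W^T = W, opbound W 1 & nuclear_norm A = \tr (W *m A)].
Proof.
move=> symA; have [V [a [VV Aa]]] := sym_spectral symA.
have VV' := mulmx1C VV.
pose W := V *m diag_mx (\row_i Num.sg (a 0 i)) *m V^T.
exists W; split.
- by rewrite /W !trmx_mul trmxK tr_diag_mx mulmxA.
- rewrite -[1]mulr1 -[1 * 1]mulr1; apply: opboundM; rewrite ?mulr1 //.
    rewrite -[1]mulr1; apply: opboundM => //; first exact: opbound_orthogonal.
    by apply: opbound_diag => // i; rewrite mxE normr_sg; case: (_ != 0); rewrite ?ler01.
  by apply: opbound_orthogonal; rewrite trmxK.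
(* The eigenvalues of A^T A are the squares a_i^2, whose roots are |a_i| = sg(a_i) a_i. *)
have AA : A^T *m A = V *m diag_mx (\row_i a 0 i ^+ 2) *m V^T.
  rewrite symA Aa -!mulmxA [V^T *m _]mulmxA VV' mul1mx [diag_mx a *m (_ *m _)]mulmxA.
  by rewrite mulmx_diag; congr (_ *m (diag_mx _ *m _)); apply/rowP => i; rewrite !mxE expr2.
rewrite /nuclear_norm AA char_poly_orthogonal // char_poly_diag.
rewrite -(big_map (fun i => (\row_i a 0 i ^+ 2) 0 i) predT (fun x : R => 'X - x%:P)).
rewrite sum_rootsR_prod big_map (mxtrace_orthogonal _ VV); apply: eq_bigr => i _.
rewrite -mulmxA [X in W *m (X *m _)]Aa spectral_eig // -scalemxAr spectral_eig //.
by rewrite !dotZr orthogonal_col // !mxE mulr1 sqrtr_sqr mulrC -normrEsg.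
Qed.

End TraceDuality.

(** * Column Nystrom residuals *)

Section Nystrom.
Context {R : realType}.

(** [xget] falls back to 0 only if no pseudoinverse exists; one is obtained by inverting the
    eigenvalues, with the convention 0^-1 = 0 treating the kernel correctly. *)
Lemma mp_pinvP n (A : 'M[R]_n) : A^T = A -> is_moore_penrose A (mp_pinv A).
Proof.
move=> symA; rewrite /mp_pinv; case: xgetP => [X _ //|none].
have [V [a [VV Aa]]] := sym_spectral symA.
have conjM (b c : 'rV_n) : V *m diag_mx b *m V^T *m (V *m diag_mx c *m V^T) =
    V *m diag_mx (\row_i (b 0 i * c 0 i)) *m V^T.
  rewrite -!mulmxA [V^T *m _]mulmxA (mulmx1C VV) mul1mx.
  by rewrite [diag_mx b *m (_ *m _)]mulmxA mulmx_diag.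
have conjT (b : 'rV_n) : (V *m diag_mx b *m V^T)^T = V *m diag_mx b *m V^T.
  by rewrite !trmx_mul trmxK tr_diag_mx mulmxA.
case: (none (V *m diag_mx (\row_i (a 0 i)^-1) *m V^T)); rewrite Aa.
split; rewrite !conjM ?conjT //; congr (V *m diag_mx _ *m V^T);
  apply/rowP => i; rewrite !mxE.
- by have [->|n0] := eqVneq (a 0 i) 0; rewrite ?mulr0 // divff // mul1r.
- by have [->|n0] := eqVneq (a 0 i) 0; rewrite ?invr0 ?mulr0 // mulVf // mul1r.
Qed.

Lemma psdmx_factor n (K : 'M[R]_n) : psdmx K -> exists F : 'M[R]_n, K = F *m F^T.
Proof.
move=> psdK; have [V [a [VV Ka]]] := sym_spectral psdK.1.
have a0 i : 0 <= a 0 i.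
  have := psdmx_dot (col i V) psdK.
  by rewrite Ka spectral_eig // dotZr orthogonal_col // mulr1.
exists (V *m diag_mx (\row_i Num.sqrt (a 0 i))).
rewrite trmx_mul tr_diag_mx mulmxA -[V *m _ *m _]mulmxA mulmx_diag Ka.
by congr (V *m diag_mx _ *m V^T); apply/rowP => i; rewrite !mxE -expr2 sqr_sqrtr.
Qed.

Lemma dot_factor m n (F : 'M[R]_(n, m)) x y :
  dot x (F *m F^T *m y) = dot (F^T *m x) (F^T *m y).
Proof. by rewrite dot_trmx trmxK mulmxA. Qed.

Lemma psdmx_mul_trmx m n (F : 'M[R]_(n, m)) : psdmx (F *m F^T).
Proof.
split; first by rewrite trmx_mul trmxK.
by move=> x; rewrite -mulmxA -/(dot _ _) dot_factor dotxx_ge0.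
Qed.

Lemma mulmx_trmx_eq0 m n (B : 'M[R]_(m, n)) : B *m B^T = 0 -> B = 0.
Proof.
move=> BB; apply/matrixP => i j.
have : dot (row i B)^T (row i B)^T = 0.
  by rewrite /dot trmxK tr_row colE mulmxA -row_mul BB row0 mul0mx mxE.
by move=> /dotxx_eq0/colP/(_ j); rewrite !mxE.
Qed.

Definition residual n (K : 'M[R]_n) S := K - nystrom K S.

(* Writing K = F F^T, the residual is F (1 - p) F^T with p the orthogonal
   projector onto the range of the rows of F indexed by S. *)
Lemma residual_spec n (K : 'M[R]_n) (S : {set 'I_n}) : psdmx K ->
  [/\ psdmx (residual K S), psdmx (nystrom K S),
      forall i, i \in S -> residual K S *m delta_mx i 0 = 0 :> 'cV_n &
      forall x : 'cV[R]_n, exists2 y : 'cV[R]_n,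
        (forall i, i \notin S -> y i 0 = 0) &
        dot x (residual K S *m x) = dot (x - y) (K *m (x - y))].
Proof.
move=> psdK; have [F KF] := psdmx_factor psdK.
rewrite /residual /nystrom; set ix := fun a : 'I_#|S| => enum_val a.
(* Multiplying by E selects the columns in S, so with H = F^T E the pivot block is the Gram matrix
   H^T H. *)
pose E : 'M[R]_(n, #|S|) := colsub ix 1%:M.
have CE : colsub ix K = K *m E by rewrite /E mulmx_colsub mulmx1.
have ME : mxsub ix ix K = E^T *m K *m E.
  rewrite -mulmxA -CE /E trmx_mxsub trmx1 mul_rowsub_mx mul1mx.
  by apply/matrixP => a b; rewrite !mxE.
rewrite ME CE; set M := E^T *m K *m E; set X := mp_pinv M.
have [H defH] : exists H, F^T *m E = H by exists (F^T *m E).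
have MH : M = H^T *m H by rewrite /M KF -defH trmx_mul trmxK !mulmxA.
have KEH : K *m E = F *m H by rewrite KF -mulmxA defH.
have [MXM _ _ _] : is_moore_penrose M X.
  by apply: mp_pinvP; rewrite MH trmx_mul trmxK.
have MXH : M *m X *m H^T = H^T.
  (* The product of this matrix with its transpose contains the factor (M X - 1) M = 0. *)
  have Z0 : (M *m X - 1%:M) *m H^T = 0.
    apply: mulmx_trmx_eq0; rewrite [X in _ *m X]trmx_mul trmxK mulmxA.
    by rewrite -(mulmxA _ H^T) -MH mulmxBl mul1mx MXM subrr mul0mx.
  by move/eqP: Z0; rewrite mulmxBl mul1mx subr_eq0 => /eqP.
have [p pE] : exists p, p = H *m X *m H^T by exists (H *m X *m H^T).
(* This one identity yields both symmetry and idempotence of p, since its left side is symmetric. *)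
have pTp : p^T *m p = p^T.
  rewrite pE !trmx_mul trmxK -!mulmxA; congr (_ *m (_ *m _)).
  by rewrite !mulmxA -MH.
have symp : p^T = p by have := congr1 trmx pTp; rewrite trmx_mul trmxK pTp.
have pp : p *m p = p by rewrite -{1}symp pTp.
have pH : p *m H = H.
  have := congr1 trmx MXH; rewrite MH !trmx_mul !trmxK => {2}<-.
  by rewrite -symp pE !trmx_mul trmxK -!mulmxA.
have NE : K *m E *m X *m (K *m E)^T = F *m p *m F^T.
  by rewrite KEH trmx_mul pE !mulmxA.
have qT : (1%:M - p)^T = 1%:M - p by rewrite linearB /= trmx1 symp.
have q2 : (1%:M - p) *m (1%:M - p)^T = 1%:M - p.
  by rewrite qT mulmxBl mul1mx mulmxBr mulmx1 pp subrr subr0.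
have RE : K - K *m E *m X *m (K *m E)^T = F *m (1%:M - p) *m (F *m (1%:M - p))^T.
  rewrite NE [(F *m _)^T]trmx_mul [RHS]mulmxA -[F *m _ *m (_ - _)^T]mulmxA q2.
  by rewrite mulmxBr mulmx1 mulmxBl -KF.
split.
- by rewrite RE; exact: psdmx_mul_trmx.
- rewrite NE (_ : _ *m _ *m _ = (F *m p) *m (F *m p)^T); first exact: psdmx_mul_trmx.
  by rewrite trmx_mul symp mulmxA -[F *m p *m p]mulmxA pp.
- move=> i iS.
  have -> : (delta_mx i 0 : 'cV[R]_n) = E *m delta_mx (enum_rank_in iS i) 0.
    rewrite -colE; apply/colP => k; rewrite !mxE /ix enum_rankK_in //.
    by rewrite eqxx andbT.
  rewrite mulmxA NE mulmxBl KEH -(mulmxA _ F^T) defH -[F *m p *m H]mulmxA pH subrr.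
  by rewrite mul0mx.
(* The witness y is supported on S and satisfies F^T (x - y) = (1 - p) F^T x: it minimizes the
   K-energy of x - y over such vectors. *)
- move=> x; exists (E *m (X *m H^T *m F^T *m x)).
    move=> i iS; rewrite mxE big1 // => a _; rewrite !mxE.
    case: eqP => [ia|]; last by rewrite mul0r.
    by move: iS; rewrite ia /ix enum_valP.
  rewrite RE dot_factor KF dot_factor.
  have -> : F^T *m (x - E *m (X *m H^T *m F^T *m x)) = (F *m (1%:M - p))^T *m x.
    rewrite trmx_mul qT mulmxBr [F^T *m (E *m _)]mulmxA defH mulmxBl mul1mx mulmxBl.
    by rewrite pE !mulmxA.
  by [].
Qed.

Lemma residual_psd n (K : 'M[R]_n) S : psdmx K -> psdmx (residual K S).
Proof. by move=> /(residual_spec S) []. Qed.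

Lemma residual_le n (K : 'M[R]_n) S x : psdmx K ->
  dot x (residual K S *m x) <= dot x (K *m x).
Proof.
move=> /(residual_spec S) [_ psdN _ _].
by rewrite mulmxBl dotBr gerBl psdmx_dot.
Qed.

(** The right side is the Schur complement of the old residual A at j, the minimum of its quadratic
    form along x - c e_j. The new residual kills the basis vectors in S and e_j, so its form at x
    may be evaluated at z - y, where K dominates it and the K-energy equals the A-energy of z. *)
Lemma residual_add_pivot n (K : 'M[R]_n) (S : {set 'I_n}) j x : psdmx K ->
  residual K S j j != 0 ->
  dot x (residual K (j |: S) *m x) <=
  dot x (residual K S *m x) - (residual K S *m x) j 0 ^+ 2 / residual K S j j.
Proof.
move=> psdK; set A := residual K S; set A' := residual K (j |: S) => Ajj.
have [_ _ _ minA] := residual_spec S psdK.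
have [_ _ A'0 _] := residual_spec (j |: S) psdK.
have symA : A^T = A by case: (residual_psd S psdK).
have symA' : A'^T = A' by case: (residual_psd (j |: S) psdK).
(* This c minimizes the A-energy of x - c e_j. *)
pose c := (A *m x) j 0 / A j j; pose z := x - c *: delta_mx j 0.
have [y y0 zE] := minA z.
have A'y : A' *m y = 0.
  apply/colP => i; rewrite mxE big1 ?mxE // => k _.
  have [kS|kS] := boolP (k \in S); last by rewrite y0 ?mulr0.
  have := congr1 (fun M : 'cV_n => M i 0) (A'0 k _).
  by rewrite inE kS orbT -colE !mxE => -> //; rewrite mul0r.
have A'e : A' *m delta_mx j 0 = 0 :> 'cV_n by rewrite A'0 // setU11.
have A'E : A' *m (z - y) = A' *m x.
  by rewrite /z !mulmxBr A'y -scalemxAr A'e scaler0 !subr0.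
have -> : dot x (A' *m x) = dot (z - y) (A' *m (z - y)).
  by rewrite A'E -[A' in RHS]symA' -dot_trmx A'E dot_trmx symA'.
apply: le_trans (residual_le _ _ psdK) _; rewrite -zE.
have Ae : A *m x - c *: (A *m delta_mx j 0) = A *m z.
  by rewrite /z mulmxBr -scalemxAr.
rewrite -/A -Ae /z dotBl !dotBr !dotZl !dotZr -mxE_dot !dot_delta.
have -> : dot x (A *m delta_mx j 0) = (A *m x) j 0.
  by rewrite -dot_delta dotC dot_trmx symA.
rewrite le_eqVlt; apply/orP; left; apply/eqP.
by rewrite /c; field.
Qed.

End Nystrom.

(** * Expected trace of the residual *)

Section PivotStep.
Context {R : realType} {n : nat}.
Variable K : 'M[R]_n.
Hypothesis psdK : psdmx K.

Definition add_pivot (S : {set 'I_n}) (o : option 'I_n) : {set 'I_n} :=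
  if o is Some j then (j |: S)%SET else S.

(** The transition operator of the Markov chain of selected sets: its k-th iterate at S is the
    expectation of F after k further steps. A stopped step [None] leaves the set unchanged. *)
Definition pivot_mean (F : {set 'I_n} -> R) (S : {set 'I_n}) : R :=
  \sum_o pivot_prob K S o * F (add_pivot S o).

Lemma sum_option (I : finType) (F : option I -> R) :
  \sum_o F o = F None + \sum_i F (Some i).
Proof.
rewrite (bigD1 None) //=; congr (_ + _).
rewrite (reindex_omap (@Some I) id) => [|[]//].
by apply: eq_bigl => i; rewrite eqxx.
Qed.

Lemma residual_diagE S j : residual_diag K S 0 j = residual K S j j.
Proof. by rewrite mxE. Qed.

Lemma residual_diag_ge0 S j : 0 <= residual_diag K S 0 j.
Proof. by rewrite residual_diagE psdmx_diag_ge0 //; apply: residual_psd. Qed.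

Lemma residual_trace S : \tr (residual K S) = \sum_j residual_diag K S 0 j.
Proof. by apply: eq_bigr => j _; rewrite residual_diagE. Qed.

Lemma residual_trace_eq0 S : (\tr (residual K S) == 0) = (residual_diag K S == 0).
Proof.
rewrite residual_trace psumr_eq0 => [|j _]; last exact: residual_diag_ge0.
apply/allP/eqP => [h|-> j _]; last by rewrite mxE eqxx.
by apply/rowP => j; rewrite [RHS]mxE; apply/eqP; have /= := h j (mem_index_enum _).
Qed.

Lemma pivot_prob_ge0 S o : 0 <= pivot_prob K S o.
Proof.
rewrite /pivot_prob; case: ifP => _; first exact: ler0n.
case: o => // j; rewrite divr_ge0 ?residual_diag_ge0 // sumr_ge0 // => l _.
exact: residual_diag_ge0.
Qed.

Lemma pivot_prob_sum S : \sum_o pivot_prob K S o = 1.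
Proof.
rewrite sum_option /pivot_prob -residual_trace_eq0; case: ifPn => t0.
  by rewrite eqxx big1 ?addr0.
by rewrite add0r -mulr_suml -residual_trace divff.
Qed.

Lemma pivot_mean_le F G S : (forall S, F S <= G S) ->
  pivot_mean F S <= pivot_mean G S.
Proof. by move=> FG; apply: ler_sum => o _; rewrite ler_wpM2l ?pivot_prob_ge0. Qed.

Lemma pivot_mean_affine F a b S :
  pivot_mean (fun S => a * F S + b) S = a * pivot_mean F S + b.
Proof.
rewrite /pivot_mean -[b in RHS]mul1r -(pivot_prob_sum S) mulr_suml mulr_sumr.
by rewrite -big_split; apply: eq_bigr => o _ /=; ring.
Qed.

Lemma iter_pivot_mean_le k F G S : (forall S, F S <= G S) ->
  iter k pivot_mean F S <= iter k pivot_mean G S.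
Proof. by move=> FG; elim: k S => [|k IH] S //=; exact: pivot_mean_le. Qed.

Lemma iter_pivot_mean_affine k F a b S :
  iter k pivot_mean (fun S => a * F S + b) S = a * iter k pivot_mean F S + b.
Proof.
elim: k S => [|k IH] S //=; rewrite -pivot_mean_affine.
by apply: eq_bigr => o _; rewrite IH.
Qed.

Lemma psdmx_cauchy_schwarz (A : 'M[R]_n) x y : psdmx A ->
  dot x (A *m y) ^+ 2 <= dot x (A *m x) * dot y (A *m y).
Proof. by case/psdmx_factor => F ->; rewrite !dot_factor cauchy_schwarz. Qed.

(** Pivot j lowers the form by (A v)_j^2 / A_jj and has probability A_jj / tr A, so the mean
    decrease is |A v|^2 / tr A; for a unit vector |A v| is at least <v, A v>. *)
Lemma pivot_mean_quadratic S v : dot v v = 1 ->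
  pivot_mean (fun S => dot v (residual K S *m v)) S <=
  dot v (residual K S *m v) -
  dot v (residual K S *m v) ^+ 2 / \tr (residual K S).
Proof.
move=> vv; rewrite /pivot_mean sum_option /pivot_prob -residual_trace_eq0.
have psdA := residual_psd S psdK.
(* At zero trace the algorithm has stopped, and the quotient by 0 is 0. *)
case: ifPn => [/eqP t0|tn0].
  by rewrite eqxx mul1r big1 => [|j _]; rewrite ?mul0r // addr0 t0 invr0 mulr0 subr0.
have tp : 0 < \tr (residual K S) by rewrite lt_def tn0 psdmx_trace_ge0.
rewrite mul0r add0r -residual_trace.
set A := residual K S in psdA tp *.
apply: (@le_trans _ _ (\sum_j (A j j / \tr A * dot v (A *m v) - (A *m v) j 0 ^+ 2 / \tr A))).
  apply: ler_sum => j _; rewrite residual_diagE -/A.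
  (* A zero diagonal entry forces (A v)_j = 0 by Cauchy-Schwarz for the form A, so nothing is lost
     on a pivot of probability zero. *)
  have [Aj0|Ajn0] := eqVneq (A j j) 0.
    have -> : (A *m v) j 0 = 0.
      apply/eqP; rewrite -sqrf_eq0 eq_le sqr_ge0 andbT -dot_delta.
      have := psdmx_cauchy_schwarz (delta_mx j 0) v psdA.
      by rewrite -mxE_dot Aj0 mul0r.
    by rewrite Aj0 !mul0r expr0n mul0r subr0.
  have Ajp : 0 < A j j by rewrite lt_def Ajn0 psdmx_diag_ge0.
  apply: le_trans (ler_wpM2l _ (residual_add_pivot v psdK Ajn0)) _.
    by rewrite divr_ge0 // ltW.
  rewrite -/A le_eqVlt; apply/orP; left; apply/eqP.
  by field; rewrite Ajn0 tn0.
rewrite sumrB -!mulr_suml -[X in X / _ * _]/(\tr A) divff // mul1r.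
rewrite lerD2l lerN2 ler_pM2r ?invr_gt0 //.
apply: le_trans (cauchy_schwarz _ _) _.
by rewrite vv mul1r dotE; apply: ler_sum => j _; rewrite expr2.
Qed.

End PivotStep.

(** * Recursion for the expected trace on a leading subspace *)

Section ExpectedTrace.
Context {R : realType} {n : nat}.
Variables (K V : 'M[R]_n) (m : nat).
Hypotheses (psdK : psdmx K) (VV : V *m V^T = 1%:M).

(** V is a general orthogonal matrix here. In the application its columns are eigenvectors of K, and
    [tail_mass V m K] is then the optimal rank-m trace error, by [eig_truncation_trace]. *)
Definition head_mass S : R :=
  \sum_(i < n | (i < m)%N) dot (col i V) (residual K S *m col i V).

Definition tail_mass (A : 'M[R]_n) : R :=
  \sum_(i < n | ~~ (i < m)%N) dot (col i V) (A *m col i V).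

Local Notation b := (tail_mass K).

Lemma head_mass_ge0 S : 0 <= head_mass S.
Proof. by apply: sumr_ge0 => i _; apply: psdmx_dot; apply: residual_psd. Qed.

Lemma trace_head_tail S :
  \tr (residual K S) = head_mass S + tail_mass (residual K S).
Proof. by rewrite (mxtrace_orthogonal _ VV) (bigID (fun i : 'I_n => i < m)%N). Qed.

Lemma tail_mass_le S : tail_mass (residual K S) <= b.
Proof. by apply: ler_sum => i _; exact: residual_le. Qed.

Lemma trace_le_head_tail S : \tr (residual K S) <= head_mass S + b.
Proof. by rewrite trace_head_tail lerD2l tail_mass_le. Qed.

Lemma head_mass_le_trace S : head_mass S <= \tr (residual K S).
Proof.
rewrite trace_head_tail lerDl; apply: sumr_ge0 => i _; apply: psdmx_dot.
exact: residual_psd.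
Qed.

Hypotheses (m0 : (0 < m)%N) (b0 : 0 < b).

(** Cauchy-Schwarz against the indicator of the first m indices, whose square length is min(m,
    n). *)
Lemma sum_sqr_head S :
  head_mass S ^+ 2 <=
  m%:R * \sum_(i < n | (i < m)%N) dot (col i V) (residual K S *m col i V) ^+ 2.
Proof.
set c := fun i => dot (col i V) (residual K S *m col i V).
pose x : 'cV[R]_n := \col_i (i < m)%N%:R.
pose y : 'cV[R]_n := \col_i ((i < m)%N%:R * c i).
have -> : head_mass S = dot x y.
  rewrite dotE /head_mass big_mkcond; apply: eq_bigr => i _ /=.
  by rewrite !mxE; case: ifP => _; rewrite ?mul1r ?mul0r.
have -> : \sum_(i < n | (i < m)%N) c i ^+ 2 = dot y y.
  rewrite dotE big_mkcond; apply: eq_bigr => i _ /=.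
  by rewrite !mxE; case: ifP => _; rewrite ?mul1r ?mul0r // expr2.
apply: le_trans (cauchy_schwarz _ _) _; rewrite ler_wpM2r ?dotxx_ge0 //.
have -> : dot x x = (\sum_(i < n | (i < m)%N) 1)%:R.
  rewrite dotE natr_sum [RHS]big_mkcond; apply: eq_bigr => i _ /=.
  by rewrite !mxE; case: ifP => _; rewrite ?mul1r ?mul0r.
rewrite ler_nat; case: (leqP m n) => mn.
  by rewrite -(big_ord_widen _ (fun=> 1%N) mn) sum1_card card_ord.
by rewrite sum1_card (leq_trans (max_card _)) // card_ord ltnW.
Qed.

(** Sum the quadratic estimate over the head columns, then bound the sum of squares below by a^2 / m
    and the trace above by a + b, where a is the head mass. *)
Lemma pivot_mean_head S :
  pivot_mean K head_mass S <=
  head_mass S - head_mass S ^+ 2 / (m%:R * (head_mass S + b)).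
Proof.
have ap := head_mass_ge0 S; have mp : 0 < m%:R :> R by rewrite ltr0n.
set A := residual K S.
apply: (@le_trans _ _ (head_mass S - (\sum_(i < n | (i < m)%N)
    dot (col i V) (A *m col i V) ^+ 2) / \tr A)).
  rewrite /head_mass mulr_suml -sumrB /pivot_mean.
  under eq_bigr => o _ do rewrite mulr_sumr.
  rewrite exchange_big /=; apply: ler_sum => i _.
  by apply: pivot_mean_quadratic => //; exact: orthogonal_col.
rewrite lerD2l lerN2.
have [t0|tn0] := eqVneq (\tr A) 0.
  have -> : head_mass S = 0.
    by apply/eqP; rewrite eq_le head_mass_ge0 andbT -t0 head_mass_le_trace.
  by rewrite expr0n mul0r t0 invr0 mulr0.
have tp : 0 < \tr A by rewrite lt_def tn0 psdmx_trace_ge0 //; apply: residual_psd.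
rewrite ler_pdivrMr ?mulr_gt0 ?ltr_wpDl // mulrAC ler_pdivlMr //.
rewrite [X in X <= _]mulrC (mulrC m%:R) [X in _ <= X]mulrCA; apply: ler_pM.
- exact: ltW.
- exact: sqr_ge0.
- exact: trace_le_head_tail.
- by rewrite mulrC; exact: sum_sqr_head.
Qed.

Let e k := iter k (pivot_mean K) head_mass finset.set0.

Lemma iter_head_ge0 k : 0 <= e k.
Proof.
(* Zero is written as an affine function so that [iter_pivot_mean_affine] evaluates its iterate. *)
apply: (@le_trans _ _ (iter k (pivot_mean K) (fun=> 0 * 0 + 0) finset.set0)).
  by rewrite (iter_pivot_mean_affine psdK k (fun=> 0)) mul0r addr0.
by apply: iter_pivot_mean_le => // S; rewrite mul0r addr0 head_mass_ge0.
Qed.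

(* Jensen's inequality for the concave map a |-> a - a^2/(m(a+b)), through its
   tangent line at e k. *)
Lemma iter_head_step k : e k.+1 <= e k - e k ^+ 2 / (m%:R * (e k + b)).
Proof.
have ep := iter_head_ge0 k; have mp : 0 < m%:R :> R by rewrite ltr0n.
(* The derivative of a^2 / (a + b) at e k is 2 s - s^2, and the tangent line has intercept - s^2
   b. *)
pose s := e k / (e k + b).
apply: (@le_trans _ _ (iter k (pivot_mean K)
    (fun S => (1 - (2 * s - s ^+ 2) / m%:R) * head_mass S + s ^+ 2 * b / m%:R) finset.set0)).
  rewrite /e iterSr; apply: iter_pivot_mean_le => // S.
  apply: le_trans (pivot_mean_head S) _; have ap := head_mass_ge0 S.
  set a := head_mass S in ap *.
  have abp : 0 < a + b by rewrite ltr_wpDl.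
  rewrite -subr_ge0.
  have -> : (1 - (2 * s - s ^+ 2) / m%:R) * a + s ^+ 2 * b / m%:R -
    (a - a ^+ 2 / (m%:R * (a + b))) = (a - s * (a + b)) ^+ 2 / (m%:R * (a + b)).
    by field; rewrite !gt_eqF.
  by rewrite divr_ge0 ?sqr_ge0 // mulr_ge0 // ltW.
rewrite iter_pivot_mean_affine // -/(e k) /s le_eqVlt; apply/orP; left; apply/eqP.
by field; rewrite !gt_eqF // ltr_wpDl.
Qed.

(* ln x - b/x decreases by at least 1/m at each step: it is minus a primitive of
   (x + b)/x^2, the inverse speed of x' = - x^2/(m(x + b)). *)
Lemma iter_head_potential k : e k = 0 \/
  0 < e k /\ ln (e k) - b / e k <= ln (\tr K) - k%:R / m%:R.
Proof.
have mp : 0 < m%:R :> R by rewrite ltr0n.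
elim: k => [|k IH].
  have := iter_head_ge0 0; rewrite le_eqVlt => /orP[/eqP <-|e0]; [by left|right].
  split => //; rewrite mul0r subr0.
  have e0K : e 0 <= \tr K.
    rewrite /e /= (le_trans (head_mass_le_trace _)) //.
    apply: ler_sum => i _; rewrite [X in X <= _]mxE_dot [X in _ <= X]mxE_dot.
    exact: residual_le.
  have := ler_ln (x := e 0) (y := \tr K).
  rewrite !posrE e0 (lt_le_trans e0 e0K) e0K => /(_ isT isT) lnK.
  by have : 0 < b / e 0 by [rewrite divr_gt0]; lra.
(* The value 0 is set apart because [ln] and the inverse are only default values there; once
   reached, it persists. *)
have := iter_head_ge0 k.+1; rewrite le_eqVlt => /orP[/eqP <-|ep]; [by left|right].
have step := iter_head_step k.
case: IH => [ek0|[xp IH]].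
  by move: step; rewrite ek0 expr0n mul0r subr0 leNgt ep.
split=> //; set x := e k in xp IH step *; set y := e k.+1 in ep step *.
have xbp : 0 < x + b by rewrite addr_gt0.
have mxb : 0 < m%:R * (x + b) by rewrite mulr_gt0.
(* The logarithm falls by at least x / (m (x + b)) by [h1] and [h2], and - b / x falls by at least b
   / (m (x + b)) by [h3]; the two amounts add up to 1 / m. *)
have h1 : ln y - ln x <= y / x - 1.
  rewrite -ln_div ?posrE //.
  have := @le_ln1Dx R (y / x - 1); rewrite [1 + _]addrC subrK; apply.
  by rewrite ltrBrDl subrr divr_gt0.
have h2 : y / x - 1 <= - x / (m%:R * (x + b)).
  rewrite lerBlDl ler_pdivrMr // (le_trans step) // le_eqVlt; apply/orP; left.
  by apply/eqP; field; rewrite !gt_eqF.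
have h3 : b / x + b / (m%:R * (x + b)) <= b / y.
  rewrite -subr_ge0.
  have -> : b / y - (b / x + b / (m%:R * (x + b))) =
     b / (x * y) * (x - x * y / (m%:R * (x + b)) - y).
    by field; rewrite !gt_eqF.
  rewrite mulr_ge0 ?divr_ge0 ?mulr_ge0 ?(ltW xp) ?(ltW ep) ?(ltW b0) //.
  have yx : y <= x.
    by rewrite (le_trans step) // gerBl divr_ge0 ?sqr_ge0 // ltW.
  have : x * y / (m%:R * (x + b)) <= x ^+ 2 / (m%:R * (x + b)).
    by rewrite ler_pM2r ?invr_gt0 // expr2 ler_pM2l.
  lra.
have h4 : - x / (m%:R * (x + b)) - b / (m%:R * (x + b)) = - m%:R^-1.
  by field; rewrite !gt_eqF.
have -> : k.+1%:R / m%:R = k%:R / m%:R + m%:R^-1 :> R by rewrite -natr1 mulrDl mul1r.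
lra.
Qed.

(** If e k exceeded eps b, the potential would exceed ln (eps b) - 1 / eps, which the lower bound on
    k makes at least ln (tr K) - k / m, against [iter_head_potential]. *)
Lemma iter_head_bound k eps : 0 < eps ->
  m%:R / eps + m%:R * ln (1 / (eps * (b / \tr K))) <= k%:R ->
  e k <= eps * b.
Proof.
move=> ep hk; have mp : 0 < m%:R :> R by rewrite ltr0n.
have [->|[xp hx]] := iter_head_potential k; first by rewrite mulr_ge0 ?ltW.
have Kp : 0 < \tr K.
  rewrite (mxtrace_orthogonal _ VV) (bigID (fun i : 'I_n => i < m)%N) /=.
  rewrite ltr_wpDl //.
  by apply: sumr_ge0 => i _; exact: psdmx_dot.
rewrite leNgt; apply/negP => xb.
have ebp : 0 < eps * b by rewrite mulr_gt0.
have l1 : ln (eps * b) < ln (e k) by rewrite ltr_ln ?posrE.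
have l2 : b / e k < eps^-1.
  by rewrite ltr_pdivrMr // mulrC ltr_pdivlMr // mulrC.
have l3 : ln (1 / (eps * (b / \tr K))) = ln (\tr K) - ln (eps * b).
  by rewrite -ln_div ?posrE //; congr ln; field; rewrite !gt_eqF.
have l4 : eps^-1 + ln (1 / (eps * (b / \tr K))) <= k%:R / m%:R.
  rewrite ler_pdivlMr // (le_trans _ hk) // le_eqVlt; apply/orP; left; apply/eqP.
  by field; rewrite gt_eqF.
lra.
Qed.

End ExpectedTrace.

(* Chen, Epperly, Tropp and Webber *)
Theorem rp_cholesky_trace (R : realType) n (K V : 'M[R]_n) m k (eps : R) :
  psdmx K -> V *m V^T = 1%:M -> 0 < tail_mass V m K -> 0 < eps ->
  m%:R / eps + m%:R * ln (1 / (eps * (tail_mass V m K / \tr K))) <= k%:R ->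
  iter k (pivot_mean K) (fun S => \tr (residual K S)) finset.set0 <=
  (1 + eps) * tail_mass V m K.
Proof.
move=> psdK VV b0 ep hk.
apply: (@le_trans _ _ (iter k (pivot_mean K)
    (fun S => 1 * head_mass K V m S + tail_mass V m K) finset.set0)).
  apply: iter_pivot_mean_le => // S; rewrite mul1r.
  exact: trace_le_head_tail.
rewrite iter_pivot_mean_affine // mul1r mulrDl mul1r addrC lerD2l.
(* For m = 0 the head is empty and its mass vanishes; the recursion, which divides by m, covers the
   other case. *)
case: m hk b0 => [|m] hk b0; last exact: iter_head_bound.
have -> : iter k (pivot_mean K) (head_mass K V 0) finset.set0 =
  iter k (pivot_mean K) (fun S => 0 * head_mass K V 0 S + 0) finset.set0.
  by congr (iter _ _ _ _); apply/funext => S; rewrite mul0r addr0 /head_mass big_pred0.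
by rewrite iter_pivot_mean_affine // mul0r addr0 mulr_ge0 ?ltW.
Qed.

(** * Law of the pivots *)

Section PivotLaw.
Context {R : realType} {disp : measure_display} {T : measurableType disp}.
Variable Pr : probability T R.

Lemma measurable_fin_preim (I : finType) (X : T -> I) (B : set I) :
  (forall i, measurable (X @^-1` [set i])) -> measurable (X @^-1` B).
Proof.
move=> mX; have -> : X @^-1` B = \bigcup_(i in B) (X @^-1` [set i]).
  by apply/seteqP; split=> [w Bw|w [i Bi /= ->]]; [exists (X w)|].
by apply: fin_bigcup_measurable => // i _.
Qed.

Lemma probability_total (I : finType) (X : T -> I) (A : set T) :
  measurable A -> (forall i, measurable (X @^-1` [set i])) ->
  (Pr A = \sum_i Pr (A `&` X @^-1` [set i]))%E.
Proof.
move=> mA mX; have -> : (\sum_i Pr (A `&` X @^-1` [set i]) =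
    \sum_(k < #|I|) Pr (A `&` X @^-1` [set enum_val k]))%E.
  exact: (reindex _ (onW_bij _ (@enum_val_bij I))).
rewrite -measure_bigsetU_ord.
- congr (Pr _); rewrite -bigcup_seq.
  apply/seteqP; split=> [w Aw|w [k _ []]//].
  by exists (enum_rank (X w)); rewrite /= ?mem_index_enum // enum_rankK.
- by move=> k; apply: measurableI.
- by move=> k l _ _ [w [[_ /= Xk] [_ /= Xl]]]; apply: enum_val_inj; rewrite -Xk.
Qed.

Context {n r : nat}.
Variables (K : 'M[R]_n) (s : 'I_r -> T -> option 'I_n).
Hypotheses (psdK : psdmx K) (sP : rp_cholesky_pivots Pr K s).

(** Every event considered depends only on the pivot vector, which takes finitely many values. *)
Lemma measurable_pivots (Q : set {ffun 'I_r -> option 'I_n}) :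
  measurable [set w | Q [ffun l => s l w]].
Proof.
apply: (@measurable_fin_preim _ (fun w => [ffun l => s l w])) => h.
have -> : (fun w => [ffun l => s l w]) @^-1` [set h] =
    \bigcap_(l in [set: 'I_r]) s l @^-1` [set h l].
  apply/seteqP; split=> [w /= <- l _ /=|w wh /=]; first by rewrite ffunE.
  by apply/ffunP => l; rewrite ffunE; exact: wh.
by apply: fin_bigcap_measurable => // l _; exact: sP.1.
Qed.

Lemma selected_ext (h h' : 'I_r -> option 'I_n) i :
  (forall l : 'I_r, (l < i)%N -> h l = h' l) -> selected h i = selected h' i.
Proof.
move=> hh; apply/setP => j; rewrite !inE; apply: eq_existsb => l.
by case: ltnP => //= /hh ->.
Qed.

Lemma selected_ffun (h : 'I_r -> option 'I_n) i :
  selected [ffun l => h l] i = selected h i.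
Proof. by apply: selected_ext => l _; rewrite ffunE. Qed.

Lemma measurable_selected (Q : set {set 'I_n}) :
  measurable [set w | Q (selected (s^~ w) r)].
Proof.
have -> : [set w | Q (selected (s^~ w) r)] =
    [set w | Q (selected [ffun l => s l w] r)].
  by apply/seteqP; split=> w /=; rewrite selected_ffun.
exact: (measurable_pivots (fun f => Q (selected f r))).
Qed.

Lemma selectedS (h : 'I_r -> option 'I_n) (i : 'I_r) :
  selected h i.+1 = add_pivot (selected h i) (h i).
Proof.
apply/setP => j; rewrite inE; apply/existsP/idP => [[l]|].
  rewrite ltnS leq_eqVlt => /andP[/orP[/eqP/val_inj ->|li] /eqP hl].
    by rewrite hl !inE eqxx.
  have jS : j \in selected h i by rewrite inE; apply/existsP; exists l; rewrite li hl eqxx.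
  by rewrite /add_pivot; case: (h i) => // j'; rewrite inE jS orbT.
rewrite /add_pivot; case hi: (h i) => [j'|].
  case/setU1P => [->|]; first by exists i; rewrite ltnSn hi eqxx.
  by rewrite inE => /existsP[l /andP[li hl]]; exists l; rewrite ltnW.
by rewrite inE => /existsP[l /andP[li hl]]; exists l; rewrite ltnW.
Qed.

(** Induction on the number k of remaining steps: split according to the next pivot and extend the
    prescribed past by it. Keeping the probability of the past as a factor avoids conditioning on
    null events. *)
Lemma pivot_law (Q : pred {set 'I_n}) k i (h : 'I_r -> option 'I_n) :
  (i + k = r)%N ->
  let past := [set w | forall l : 'I_r, (l < i)%N -> s l w = h l] in
  Pr (past `&` [set w | Q (selected (s^~ w) r)]) =
  (Pr past *
   (iter k (pivot_mean K) (fun S => (Q S)%:R) (selected h i))%:E)%E.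
Proof.
elim: k i h => [|k IH] i h.
  rewrite addn0 => -> past /=; have [Qh|Qh] := boolP (Q (selected h r)).
    rewrite mule1; congr (Pr _); apply/seteqP; split=> [w []//|w wh]; split => //=.
    by rewrite (@selected_ext _ h).
  rewrite mule0 -(@measure0 _ _ _ Pr); congr (Pr _); apply/seteqP; split=> // w [wh /=].
  by rewrite (@selected_ext _ h) // (negPf Qh).
move=> ikr past; have ir : (i < r)%N by rewrite -ikr addnS ltnS leq_addr.
pose i' := Ordinal ir.
(* The past h prolonged by the outcome o at step i. *)
pose upd o := fun l : 'I_r => if l == i' then o else h l.
have upd_lt o (l : 'I_r) : (l < i)%N -> upd o l = h l.
  by move=> li; rewrite /upd -val_eqE /= ltn_eqF.
have mpast : measurable past.
  have -> : past = [set w | forall l : 'I_r, (l < i)%N -> [ffun l => s l w] l = h l].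
    by apply/seteqP; split=> w wh l /wh /=; rewrite ffunE.
  exact: (measurable_pivots (fun f => forall l : 'I_r, (l < i)%N -> f l = h l)).
have mQ := measurable_selected Q.
have pastS o : past `&` s i' @^-1` [set o] =
    [set w | forall l : 'I_r, (l < i.+1)%N -> s l w = upd o l].
  apply/seteqP; split=> [w [wh /= wo] l|w wh].
    rewrite ltnS leq_eqVlt => /orP[/eqP li|li].
      have -> : l = i' by exact: val_inj.
      by rewrite /upd eqxx.
    by rewrite upd_lt // wh.
  split=> [l li|/=]; first by rewrite wh ?upd_lt // ltnW.
  by rewrite wh /upd ?eqxx.
rewrite (@probability_total _ (s i')) => [|/=|]; [|exact: measurableI|exact: sP.1].
have Pp : Pr past = (fine (Pr past))%:E by rewrite fineK ?fin_num_measure.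
rewrite [iter k.+1 _ _]/= /pivot_mean Pp -EFinM mulr_sumr -sumEFin.
apply: eq_bigr => o _; rewrite setIAC pastS IH; last by rewrite addSnnS.
have sel : selected (upd o) i = selected h i by apply: selected_ext => l /upd_lt.
rewrite (@selectedS (upd o) i') /= sel (_ : upd o i' = o); last by rewrite /upd eqxx.
have := sP.2 (upd o) i'; rewrite /= sel (_ : upd o i' = o); last by rewrite /upd eqxx.
rewrite (_ : [set w | forall l : 'I_r, (l < i)%N -> s l w = upd o l] = past).
  by move=> ->; rewrite Pp -!EFinM mulrA.
by apply/seteqP; split=> w wh l li; rewrite wh ?upd_lt.
Qed.

(** Markov's inequality inside the iterated mean: c times the indicator of a trace at least c is
    bounded by the trace. The empty past in [pivot_law] identifies the mean of the indicator with a
    probability. *)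
Lemma markov_residual (c : R) : 0 < c ->
  (1 - (iter r (pivot_mean K) (fun S => \tr (residual K S)) finset.set0 / c)%:E <=
   Pr [set w | (\tr (residual K (selected (s^~ w) r)) < c)%R])%E.
Proof.
move=> c0; have -> : [set w | \tr (residual K (selected (s^~ w) r)) < c] =
   ~` [set w | c <= \tr (residual K (selected (s^~ w) r))].
  by apply/seteqP; split=> w /=; rewrite ltNge => /negP.
pose Q S := c <= \tr (residual K S).
have h0 (l : 'I_r) : option 'I_n by exact: None.
have := @pivot_law Q r 0 h0 (add0n r) => /=.
have -> : [set w | forall l : 'I_r, (l < 0)%N -> s l w = h0 l] = setT.
  by apply/seteqP; split.
rewrite setTI probability_setT mul1e => PQ.
have sel0 : selected h0 0 = finset.set0.
  by apply/setP => j; rewrite !inE; apply/existsP => -[l].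
rewrite probability_setC; last exact: (measurable_selected Q).
rewrite PQ sel0 -!EFinB lee_fin lerD2l lerN2 ler_pdivlMr // mulrC.
rewrite -[X in X <= _]addr0 -iter_pivot_mean_affine //.
apply: iter_pivot_mean_le => // S; rewrite addr0 /Q.
by case: (leP c) => [ctr|_]; rewrite ?mulr1 // mulr0 psdmx_trace_ge0 //; apply: residual_psd.
Qed.

End PivotLaw.

(** * Perturbation of the normalization *)

Lemma subcolE (R : realType) n (x y : 'cV[R]_n) i : (x - y) i 0 = x i 0 - y i 0.
Proof. by rewrite !mxE. Qed.

Section Minimum.
Context {R : realType} {n : nat}.
Implicit Types x : 'cV[R]_n.

Lemma vmin_le x i : vmin x <= x i 0.
Proof.
apply: ge_inf; last by exists i.
exists (- l2norm x) => _ [j _ <-].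
by have := l2norm_entry x j; rewrite ler_norml => /andP[].
Qed.

(** The infimum over a nonempty finite index set is attained, so strictness survives. *)
Lemma vmin_gt x c : (0 < n)%N -> (forall i, c < x i 0) -> c < vmin x.
Proof.
move=> n0 cx; pose i0 := Ordinal n0.
have [i _ imin] := @arg_minP _ _ _ i0 xpredT (fun i => x i 0) isT.
apply: lt_le_trans (cx i) _; apply: lb_le_inf; first by exists (x i0 0), i0.
by move=> _ [j _ <-]; exact: imin.
Qed.

End Minimum.

Section Diagonal.
Context {R : realType} {n : nat}.

Lemma invmx_diag (a : 'rV[R]_n) : (forall i, a 0 i != 0) ->
  invmx (diag_mx a) = diag_mx (\row_i (a 0 i)^-1).
Proof.
move=> a0; have aV : diag_mx a *m diag_mx (\row_i (a 0 i)^-1) = 1%:M.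
  rewrite mulmx_diag -diag_const_mx; congr diag_mx.
  by apply/rowP => i; rewrite !mxE divff.
have [aU _] := mulmx1_unit aV.
by rewrite -[LHS]mulmx1 -aV mulmxA mulVmx // mul1mx.
Qed.

Lemma invmx_diag_sqrt (q : 'cV[R]_n) : (forall i, 0 < q i 0) ->
  invmx (diag_mx q^T) = diag_mx (\row_i (Num.sqrt (q i 0))^-1) *m
    diag_mx (\row_i (Num.sqrt (q i 0))^-1).
Proof.
move=> q0; rewrite invmx_diag => [|i]; last by rewrite mxE gt_eqF.
rewrite mulmx_diag; congr diag_mx; apply/rowP => i.
by rewrite !mxE -invfM -expr2 sqr_sqrtr // ltW.
Qed.

Lemma mxtraceN (A : 'M[R]_n) : \tr (- A) = - \tr A.
Proof. exact: linearN. Qed.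

(** Cyclicity brings the right diagonal factor to the front, leaving trace duality for the positive
    semidefinite A. *)
Lemma mxtrace_sandwich_le (A B : 'M[R]_n) (a b : 'rV[R]_n) ca cb c :
  psdmx A -> 0 <= c -> 0 <= ca -> 0 <= cb -> opbound B c ->
  (forall i, `|a 0 i| <= ca) -> (forall i, `|b 0 i| <= cb) ->
  \tr (B *m (diag_mx a *m A *m diag_mx b)) <= c * (ca * cb * \tr A).
Proof.
move=> psdA c0 ca0 cb0 hB ha hb.
rewrite mulmxA mxtrace_mulC !mulmxA.
have -> : c * (ca * cb * \tr A) = cb * c * ca * \tr A by ring.
apply: le_trans (ler_norm _) _; apply: mxtrace_psd_le => //.
  by rewrite !mulr_ge0.
apply: opboundM; [by rewrite mulr_ge0| |exact: opbound_diag].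
by apply: opboundM => //; exact: opbound_diag.
Qed.

(** Telescoping with one factor changed at a time, ordered so that only [A - At] and [A], to which
    positive semidefiniteness will apply, occur in the middle. *)
Lemma diag_sandwich_sub (A At : 'M[R]_n) (a at_ b bt : 'rV[R]_n) :
  diag_mx a *m A *m diag_mx b - diag_mx at_ *m At *m diag_mx bt =
  diag_mx at_ *m (A - At) *m diag_mx bt + diag_mx at_ *m A *m diag_mx (b - bt) +
  diag_mx (a - at_) *m A *m diag_mx b.
Proof.
apply/matrixP => i j; rewrite !mul_mx_diag !mul_diag_mx !mxE; ring.
Qed.

End Diagonal.

(** The constant is the absolute derivative of x^(-1/2) at s, its largest value on [s, oo). Passing
    to square roots makes the inequality rational. *)
Lemma inv_sqrt_dist (R : realType) (s x y : R) : 0 < s -> s <= x -> s <= y ->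
  `|(Num.sqrt x)^-1 - (Num.sqrt y)^-1| <= `|x - y| / (2 * (s * Num.sqrt s)).
Proof.
move=> s0 sx sy; have x0 := lt_le_trans s0 sx; have y0 := lt_le_trans s0 sy.
rewrite -{2}(sqr_sqrtr (ltW x0)) -{2}(sqr_sqrtr (ltW y0)) -{1}(sqr_sqrtr (ltW s0)).
have : Num.sqrt s <= Num.sqrt x by rewrite ler_sqrt // ltW.
have : Num.sqrt s <= Num.sqrt y by rewrite ler_sqrt // ltW.
have : 0 < Num.sqrt s by rewrite sqrtr_gt0.
move: (Num.sqrt s) (Num.sqrt x) (Num.sqrt y) => {s0 sx sy x0 y0 x y}s x y s0 sy sx.
have x0 := lt_le_trans s0 sx; have y0 := lt_le_trans s0 sy.
have -> : x^-1 - y^-1 = - ((x ^+ 2 - y ^+ 2) / (x * y * (x + y))).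
  by field; rewrite !gt_eqF // addr_gt0.
have p0 : 0 < x * y * (x + y) by rewrite !mulr_gt0 // addr_gt0.
rewrite normrN normrM normfV (gtr0_norm p0) ler_wpM2l // lef_pV2 ?posrE //.
  have -> : 2 * (s ^+ 2 * s) = s * s * (s + s) by ring.
  by rewrite ler_pM ?ler_pM ?lerD ?mulr_ge0 ?addr_ge0 // ltW.
by rewrite !mulr_gt0 // exprn_gt0.
Qed.

Lemma l2norm_inv_dist (R : realType) n (x y : 'cV[R]_n) a : 0 < a ->
  (forall i, a < x i 0) -> (forall i, a < y i 0) ->
  l2norm (\col_i (x i 0)^-1 - \col_i (y i 0)^-1) <= l2norm (x - y) / a ^+ 2.
Proof.
move=> a0 xa ya.
have x0 i : 0 < x i 0 by apply: lt_trans (xa i).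
have y0 i : 0 < y i 0 by apply: lt_trans (ya i).
have -> : \col_i (x i 0)^-1 - \col_i (y i 0)^-1 =
    diag_mx (\row_i - (x i 0 * y i 0)^-1) *m (x - y).
  by apply/colP => i; rewrite mul_diag_mx !mxE; field; rewrite !gt_eqF.
rewrite mulrC; apply: opbound_diag => [|i].
  by rewrite invr_ge0 exprn_ge0 // ltW.
rewrite mxE normrN gtr0_norm ?invr_gt0 ?mulr_gt0 //.
rewrite lef_pV2 ?posrE ?exprn_gt0 ?mulr_gt0 // expr2.
by apply: ler_pM => //; exact: ltW.
Qed.

Lemma weighted_cauchy_schwarz (R : realType) n (w x : 'I_n -> R) :
  (forall i, 0 <= w i) ->
  (\sum_i w i * x i) ^+ 2 <= (\sum_i w i * x i ^+ 2) * \sum_i w i.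
Proof.
move=> w0; pose u : 'cV[R]_n := \col_i Num.sqrt (w i).
pose v : 'cV[R]_n := \col_i (Num.sqrt (w i) * x i).
have := cauchy_schwarz v u; rewrite !dotE.
congr (_ <= _); first congr (_ ^+ 2); last congr (_ * _);
  apply: eq_bigr => i _; rewrite !mxE.
- by rewrite mulrAC -expr2 sqr_sqrtr.
- by rewrite -expr2 exprMn sqr_sqrtr.
- by rewrite -expr2 sqr_sqrtr.
Qed.

Lemma nuclear_norm_gram_sub (R : realType) n (G Gt : 'M[R]_n) :
  exists2 W : 'M[R]_n, opbound W 1 &
  nuclear_norm (G^T *m G - Gt^T *m Gt) = \tr (W *m (G^T + Gt^T) *m (G - Gt)).
Proof.
have [|W [symW hW ->]] := @nuclear_norm_sym R n (G^T *m G - Gt^T *m Gt).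
  by rewrite linearB /= !trmx_mul !trmxK.
exists W => //; rewrite 2!mulmxBr mulmxDr !mulmxDl !mulmxA.
rewrite !mxtraceD !mxtraceN !mxtraceD.
(* The cross terms cancel: W is symmetric, so transposition and cyclicity exchange them. *)
have -> : \tr (W *m Gt^T *m G) = \tr (W *m G^T *m Gt).
  by rewrite -mxtrace_tr !trmx_mul trmxK symW mulmxA mxtrace_mulC mulmxA.
by ring.
Qed.

(** * Gram form and contraction property of the normalized matrix *)

Section Normalization.
Context {R : realType} {n : nat}.
Variable K : 'M[R]_n.
Hypothesis dn0 : forall i, dvec K i 0 != 0.

Lemma invmx_Dmx : invmx (Dmx K) = diag_mx (\row_i (dvec K i 0)^-1).
Proof.
rewrite invmx_diag => [|i]; last by rewrite mxE.
by congr diag_mx; apply/rowP => i; rewrite !mxE.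
Qed.

Lemma qvecE : qvec K = K *m \col_i (dvec K i 0)^-1.
Proof.
rewrite /qvec invmx_Dmx -mulmxA; congr (_ *m _); apply/colP => i.
by rewrite mul_diag_mx !mxE mulr1.
Qed.

Lemma GmxE : Gmx K = diag_mx (\row_i (Num.sqrt (qvec K i 0))^-1) *m K *m
  diag_mx (\row_i (dvec K i 0)^-1).
Proof. by rewrite /Gmx invmx_Dmx. Qed.

Hypothesis symK : K^T = K.

Lemma Pmx_gram : (forall i, 0 < qvec K i 0) -> Pmx K = (Gmx K)^T *m Gmx K.
Proof.
move=> q0; rewrite /Pmx /Qmx invmx_diag_sqrt //.
by rewrite GmxE invmx_Dmx !trmx_mul !tr_diag_mx symK !mulmxA.
Qed.

(* Row i of G is bounded by Cauchy-Schwarz with weights K i j / d j, whose sum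
   over j is q i and whose sum over i is 1. *)
Lemma Gmx_opbound : (forall i j, 0 <= K i j) -> (forall i, 0 < dvec K i 0) ->
  (forall i, 0 < qvec K i 0) -> opbound (Gmx K) 1.
Proof.
move=> K0 d0 q0 x; rewrite mul1r l2norm_leP ?l2norm_ge0 // l2norm_sqr.
set d := dvec K in d0 *; set q := qvec K in q0 *.
have w0 i j : 0 <= K i j / d j 0 by rewrite divr_ge0 // ltW.
have row_le i : (Gmx K *m x) i 0 ^+ 2 <= \sum_j K i j / d j 0 * x j 0 ^+ 2.
  have -> : (Gmx K *m x) i 0 = (Num.sqrt (q i 0))^-1 * \sum_j K i j / d j 0 * x j 0.
    rewrite GmxE -!mulmxA mul_diag_mx !mxE; congr (_ * _); apply: eq_bigr => j _.
    by rewrite mul_diag_mx !mxE mulrA.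
  rewrite exprMn exprVn sqr_sqrtr; last exact: ltW.
  rewrite mulrC ler_pdivrMr //.
  have -> : q i 0 = \sum_j K i j / d j 0.
    by rewrite /q qvecE mxE; apply: eq_bigr => j _; rewrite [X in _ * X]mxE.
  exact: weighted_cauchy_schwarz.
rewrite dotE (eq_bigr (fun i => (Gmx K *m x) i 0 ^+ 2)) => [|i _]; last by rewrite expr2.
apply: le_trans (ler_sum _ (fun i _ => row_le i)) _.
rewrite exchange_big dotE le_eqVlt /=; apply/orP; left; apply/eqP.
apply: eq_bigr => j _; rewrite -mulr_suml -expr2 -mulr_suml.
have -> : \sum_i K i j = d j 0.
  by rewrite /d /dvec mxE; apply: eq_bigr => i _; rewrite -{1}symK !mxE mulr1.
by rewrite divff ?mul1r.
Qed.

End Normalization.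

(** * Deterministic bound for a given trace error *)

Section Perturbation.
Context {R : realType} {n : nat}.
Variables (K Kt : 'M[R]_n) (tau : R).
Hypotheses (n0 : (0 < n)%N) (psdK : psdmx K) (K0 : forall i j, 0 <= K i j).
Hypotheses (symKt : Kt^T = Kt) (psdE : psdmx (K - Kt)) (Etau : \tr (K - Kt) < tau).

Local Notation sn := (Num.sqrt (n%:R : R)).
Local Notation delta := (\tr (K - Kt)).
(** Here [tau] stands for t zeta. Distances are estimated with the actual trace error [delta], and
    strict inequalities come from [delta] < [tau]. *)
Let alpha := vmin (dvec K) - sn * tau.
Let beta : R := sn * tau / alpha * (1 + opnorm K / alpha).
Let qb := vmin (qvec K) - beta.
Hypotheses (alpha0 : 0 < alpha) (qb0 : 0 < qb).

Let sn0 : 0 < sn.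
Proof. by rewrite sqrtr_gt0 ltr0n. Qed.

Let delta0 : 0 <= delta.
Proof. exact: psdmx_trace_ge0. Qed.

Let tau0 : 0 < tau.
Proof. exact: le_lt_trans Etau. Qed.

(** The difference is K - Kt applied to the vector of ones, and its trace bounds the operator norm
    of K - Kt. *)
Lemma dvec_dist : l2norm (dvec K - dvec Kt) <= sn * delta.
Proof.
rewrite -mulmxBl; apply: le_trans (psdmx_opbound psdE _) _.
by rewrite l2norm_const1 mulrC.
Qed.

Lemma dvec_gt i : alpha < dvec K i 0.
Proof.
by apply: lt_le_trans (vmin_le _ _); rewrite /alpha ltrBlDr ltrDl mulr_gt0.
Qed.

Lemma dvec_approx_gt i : alpha < dvec Kt i 0.
Proof.
have := le_trans (l2norm_entry (dvec K - dvec Kt) i) dvec_dist.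
rewrite subcolE ler_norml => /andP[_ h].
have : sn * delta < sn * tau by rewrite ltr_pM2l.
by have := vmin_le (dvec K) i; rewrite /alpha; lra.
Qed.

Let di : 'cV[R]_n := \col_i (dvec K i 0)^-1.
Let dti : 'cV[R]_n := \col_i (dvec Kt i 0)^-1.

Let dp i : 0 < dvec K i 0. Proof. exact: lt_trans (dvec_gt i). Qed.
Let dtp i : 0 < dvec Kt i 0. Proof. exact: lt_trans (dvec_approx_gt i). Qed.
Let dn i : dvec K i 0 != 0. Proof. by rewrite gt_eqF. Qed.
Let dtn i : dvec Kt i 0 != 0. Proof. by rewrite gt_eqF. Qed.

Let inva x : alpha < x -> `|x^-1| <= alpha^-1.
Proof.
move=> ax; have x0 := lt_trans alpha0 ax.
by rewrite gtr0_norm ?invr_gt0 // lef_pV2 ?posrE // ltW.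
Qed.

Let diS i : `|di i 0| <= alpha^-1.
Proof. by rewrite [di i 0]mxE inva ?dvec_gt. Qed.

Let dtiS i : `|dti i 0| <= alpha^-1.
Proof. by rewrite [dti i 0]mxE inva ?dvec_approx_gt. Qed.

Lemma inv_dvec_dist : l2norm (di - dti) <= sn * delta / alpha ^+ 2.
Proof.
apply: le_trans (l2norm_inv_dist alpha0 dvec_gt dvec_approx_gt) _.
by rewrite ler_pM2r ?invr_gt0 ?exprn_gt0 // dvec_dist.
Qed.

Lemma qvec_dist :
  l2norm (qvec K - qvec Kt) <= sn * delta / alpha * (1 + opnorm K / alpha).
Proof.
rewrite !qvecE // -/di -/dti.
(* The first term is controlled by the trace of K - Kt and |dti| <= sqrt n / alpha, the second by
   [opnorm K] and [inv_dvec_dist]. *)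
have -> : K *m di - Kt *m dti = (K - Kt) *m dti + K *m (di - dti).
  by rewrite mulmxBl mulmxBr [RHS]addrC addrA subrK.
apply: le_trans (l2normD _ _) _; rewrite mulrDr mulr1; apply: lerD.
  apply: le_trans (psdmx_opbound psdE _) _.
  have -> : sn * delta / alpha = delta * (alpha^-1 * sn) by ring.
  rewrite ler_wpM2l // -l2norm_const1.
  have -> : dti = diag_mx dti^T *m const_mx 1.
    by apply/colP => i; rewrite mul_diag_mx [RHS]mxE [dti^T 0 i]mxE [const_mx _ _ _]mxE mulr1.
  apply: opbound_diag => [|i]; first by rewrite invr_ge0 ltW.
  by rewrite mxE.
apply: le_trans (opnorm_opbound _ _) _.
have -> : sn * delta / alpha * (opnorm K / alpha) = opnorm K * (sn * delta / alpha ^+ 2).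
  by field; rewrite gt_eqF.
by rewrite ler_wpM2l ?opnorm_ge0 // inv_dvec_dist.
Qed.

Let amp0 : 0 < 1 + opnorm K / alpha.
Proof. by rewrite ltr_pwDl // divr_ge0 ?opnorm_ge0 // ltW. Qed.

Lemma qvec_gt i : qb < qvec K i 0.
Proof.
apply: lt_le_trans (vmin_le _ _); rewrite /qb ltrBlDr ltrDl.
by rewrite mulr_gt0 // divr_gt0 // mulr_gt0.
Qed.

Lemma qvec_approx_gt i : qb < qvec Kt i 0.
Proof.
have := le_trans (l2norm_entry (qvec K - qvec Kt) i) qvec_dist.
rewrite subcolE ler_norml => /andP[_ h].
have : sn * delta / alpha * (1 + opnorm K / alpha) < beta.
  by rewrite /beta ltr_pM2r // ltr_pM2r ?invr_gt0 // ltr_pM2l.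
by have := vmin_le (qvec K) i; rewrite /qb; lra.
Qed.

Let qp i : 0 < qvec K i 0. Proof. exact: lt_trans (qvec_gt i). Qed.
Let qtp i : 0 < qvec Kt i 0. Proof. exact: lt_trans (qvec_approx_gt i). Qed.

Let bracket : R := 1 / (Num.sqrt qb * alpha)
  + sn * \tr K / (Num.sqrt qb * alpha ^+ 2)
  + sn * \tr K / (2 * qb `^ (3 / 2) * alpha ^+ 2) * (1 + opnorm K / alpha).

Lemma powR32 : qb `^ (3 / 2) = qb * Num.sqrt qb.
Proof.
have -> : 3 / 2 = 1 + 2^-1 :> R by field.
by rewrite powRD ?(gt_eqF qb0) ?implybT // powRr1 ?ltW // powR12_sqrt ?ltW.
Qed.

(** The summands of [bracket] account in order for replacing K, D^-1 and Q^(-1/2) in the telescoped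
    difference. *)
Lemma mxtrace_Gmx_dist (B : 'M[R]_n) c : 0 <= c -> opbound B c ->
  \tr (B *m (Gmx K - Gmx Kt)) <= c * (bracket * delta).
Proof.
move=> c0 hB; have sq0 : 0 < Num.sqrt qb by rewrite sqrtr_gt0.
pose a : 'rV[R]_n := \row_i (Num.sqrt (qvec K i 0))^-1.
pose at_ : 'rV[R]_n := \row_i (Num.sqrt (qvec Kt i 0))^-1.
have -> : Gmx K - Gmx Kt = diag_mx at_ *m (K - Kt) *m diag_mx dti^T +
    diag_mx at_ *m K *m diag_mx (di - dti)^T + diag_mx (a - at_) *m K *m diag_mx di^T.
  rewrite !GmxE // -/a -/at_.
  have -> : \row_i (dvec K i 0)^-1 = di^T by apply/rowP => i; rewrite !mxE.
  have -> : \row_i (dvec Kt i 0)^-1 = dti^T by apply/rowP => i; rewrite !mxE.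
  by rewrite diag_sandwich_sub -[_^T - _^T]linearB.
have aS i : `|at_ 0 i| <= (Num.sqrt qb)^-1.
  rewrite mxE gtr0_norm ?invr_gt0 ?sqrtr_gt0 // lef_pV2 ?posrE ?sqrtr_gt0 //.
  by rewrite ler_sqrt // ltW // qvec_approx_gt.
have adS i : `|(a - at_) 0 i| <=
    sn * delta / alpha * (1 + opnorm K / alpha) / (2 * (qb * Num.sqrt qb)).
  rewrite [(a - at_) 0 i]mxE [(- at_) 0 i]mxE [a 0 i]mxE [at_ 0 i]mxE.
  apply: le_trans (inv_sqrt_dist qb0 (ltW (qvec_gt i)) (ltW (qvec_approx_gt i))) _.
  rewrite ler_pM2r ?invr_gt0 ?mulr_gt0 //.
  have := le_trans (l2norm_entry (qvec K - qvec Kt) i) qvec_dist.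
  by rewrite subcolE.
have dS i : `|di^T 0 i| <= alpha^-1 by rewrite mxE.
have dtS i : `|dti^T 0 i| <= alpha^-1 by rewrite mxE.
have ddS i : `|(di - dti)^T 0 i| <= sn * delta / alpha ^+ 2.
  by rewrite mxE; apply: le_trans (l2norm_entry _ _) inv_dvec_dist.
have sq0' := ltW sq0; have al0' := ltW alpha0; have sn0' := ltW sn0.
rewrite 2!mulmxDr 2!mxtraceD.
apply: (le_trans (lerD (lerD
  (mxtrace_sandwich_le psdE c0 _ _ hB aS dtS)
  (mxtrace_sandwich_le psdK c0 _ _ hB aS ddS))
  (mxtrace_sandwich_le psdK c0 _ _ hB adS dS)));
  rewrite ?invr_ge0 ?mulr_ge0 ?invr_ge0 ?exprn_ge0 ?mulr_ge0 ?(ltW amp0) ?(ltW qb0) //.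
rewrite -!mulrDr ler_wpM2l // le_eqVlt; apply/orP; left; apply/eqP.
by rewrite /bracket powR32; field; rewrite !gt_eqF.
Qed.

Lemma perturbation_bound :
  [/\ alpha < vmin (dvec Kt), qb < vmin (qvec Kt) &
   nuclear_norm (Pmx K - Pmx Kt) < (1 + opnorm (Gmx Kt)) * bracket * tau].
Proof.
split; [exact: vmin_gt dvec_approx_gt|exact: vmin_gt qvec_approx_gt|].
have symK := psdK.1.
rewrite !Pmx_gram //; set G := Gmx K; set Gt := Gmx Kt.
have [W hW ->] := nuclear_norm_gram_sub G Gt.
have c0 : 0 <= 1 + opnorm Gt by rewrite addr_ge0 // opnorm_ge0.
(* Both W and G have norm at most 1. *)
have hB : opbound (W *m (G^T + Gt^T)) (1 + opnorm Gt).
  rewrite -[1 + _]mul1r; apply: opboundM => //; apply: opboundD.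
    by apply: opbound_trmx => //; apply: Gmx_opbound.
  by apply: opbound_trmx; [exact: opnorm_ge0|exact: opnorm_opbound].
(* Replacing [delta] by [tau] is strict because its coefficient is positive, thanks to the first
   summand of [bracket]. *)
apply: le_lt_trans (mxtrace_Gmx_dist c0 hB) _; rewrite mulrA ltr_pM2l //.
have sq0 : 0 < Num.sqrt qb by rewrite sqrtr_gt0.
have trK0 := psdmx_trace_ge0 psdK.
apply: mulr_gt0; first by rewrite ltr_pwDl ?opnorm_ge0.
have al0 := ltW alpha0; have am0 := ltW amp0; have sn0' := ltW sn0.
rewrite /bracket -addrA ltr_pwDl //; first by rewrite divr_gt0 // mulr_gt0.
rewrite addr_ge0 ?mulr_ge0 ?invr_ge0 ?mulr_ge0 ?exprn_ge0 ?powR_ge0 //.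
Qed.

End Perturbation.

(** * Probability estimate for the kernel matrix *)

Lemma eig_truncation_trace (R : realType) n (A B V : 'M[R]_n) (lam : 'rV[R]_n) m :
  V *m V^T = 1%:M -> A = V *m diag_mx lam *m V^T ->
  B = V *m diag_mx (\row_i (if (i < m)%N then lam 0 i else 0)) *m V^T ->
  \tr (A - B) = tail_mass V m A.
Proof.
move=> VV AE BE; rewrite (mxtrace_orthogonal _ VV) /tail_mass [RHS]big_mkcond.
apply: eq_bigr => i _; rewrite mulmxBl dotBr AE BE !spectral_eig //.
rewrite !dotZr orthogonal_col // mxE !mulr1.
by case: (i < m)%N; rewrite ?subrr ?subr0.
Qed.

Theorem corollary9 (R : realType) (d : nat)
    (k : 'rV[R]_d -> 'rV[R]_d -> R) (hk : admissible_kernel k)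
    (N : nat) (u : 'I_N -> 'rV[R]_d)
    (r' r : nat) (eps t : R) (Kr' : 'M[R]_N)
    (disp : measure_display) (T : measurableType disp) (Pr : probability T R)
    (s : 'I_r -> T -> option 'I_N) :
  let K := kernel_mx k u in
  let zeta := (1 + eps) * \tr (K - Kr') in
  let eta := \tr (K - Kr') / \tr K in
  let alpha := vmin (dvec K) - Num.sqrt N%:R * t * zeta in
  let beta :=
    Num.sqrt N%:R * t * zeta / alpha * (1 + opnorm K / alpha) in
  let qb := vmin (qvec K) - beta in
  0 < eps ->
  eig_truncation K r' Kr' ->
  0 < \tr (K - Kr') ->
  (r' <= r)%N -> (r < N)%N ->
  r'%:R / eps + r'%:R * ln (1 / (eps * eta)) <= r%:R ->
  1 < t -> 0 < alpha -> beta < vmin (qvec K) ->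
  rp_cholesky_pivots Pr K s ->
  let Kt := rp_cholesky_output K s in
  ((1 - 1 / t)%:E <=
   Pr [set w |
     [/\ alpha < vmin (dvec (Kt w)) /\ (0 < alpha)%R,
         qb < vmin (qvec (Kt w)) /\ (0 < qb)%R &
         nuclear_norm (Pmx K - Pmx (Kt w)) <
         (1 + opnorm (Gmx (Kt w))) *
         (1 / (Num.sqrt qb * alpha)
          + Num.sqrt N%:R * \tr K / (Num.sqrt qb * alpha ^+ 2)
          + Num.sqrt N%:R * \tr K / (2 * qb `^ (3 / 2) * alpha ^+ 2)
            * (1 + opnorm K / alpha))
         * (t * zeta)]%R])%E.
Proof.
move=> K zeta eta alpha beta qb eps0 [V [lam [VV _ KE Kr'E]]] tr0 _ rN hr t1 al0.
move=> betaq sP; lazy zeta; set Kt := rp_cholesky_output K s.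
have [_ _ [_ /(_ N u) psdK] kpos] := hk; rewrite -/K in psdK.
have zE := eig_truncation_trace VV KE Kr'E.
have zeta0 : 0 < zeta by rewrite mulr_gt0 // addr_gt0.
have t0 : 0 < t by exact: lt_trans t1.
have tz0 : 0 < t * zeta by rewrite mulr_gt0.
have mean : iter r (pivot_mean K) (fun S => \tr (residual K S)) finset.set0 <= zeta.
  by rewrite /zeta zE; apply: rp_cholesky_trace; rewrite -?zE.
(* The event of trace error below t zeta has probability at least 1 - 1/t by Markov, and it is
   contained in the event claimed. *)
apply: (@le_trans _ _ (Pr [set w | \tr (residual K (selected (s^~ w) r)) < t * zeta])).
  apply: le_trans (markov_residual psdK sP tz0).
  rewrite -EFinB lee_fin lerD2l lerN2 ler_pdivrMr //.
  by rewrite div1r mulKf // gt_eqF.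
apply: le_measure; rewrite ?inE.
- exact: (measurable_selected sP (fun S => \tr (residual K S) < t * zeta)).
(* The claimed event depends on w only through the selected set, hence is measurable. *)
- pose good (A : 'M[R]_N) := [/\ alpha < vmin (dvec A) /\ 0 < alpha,
    qb < vmin (qvec A) /\ 0 < qb &
    nuclear_norm (Pmx K - Pmx A) < (1 + opnorm (Gmx A)) *
      (1 / (Num.sqrt qb * alpha) + Num.sqrt N%:R * \tr K / (Num.sqrt qb * alpha ^+ 2)
       + Num.sqrt N%:R * \tr K / (2 * qb `^ (3 / 2) * alpha ^+ 2)
         * (1 + opnorm K / alpha)) * (t * zeta)].
  exact: (measurable_selected sP (fun S => good (nystrom K S))).
- move=> w /= tw; have qb0 : 0 < qb by rewrite subr_gt0.
  have psdE := residual_psd (selected (s^~ w) r) psdK.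
  have [_ [symKt _] _ _] := residual_spec (selected (s^~ w) r) psdK.
  have K0 i j : 0 <= K i j by rewrite mxE ltW.
  have := @perturbation_bound R N K (Kt w) (t * zeta) (leq_ltn_trans (leq0n r) rN)
    psdK K0 symKt psdE tw.
  by rewrite [Num.sqrt _ * (t * zeta)]mulrA => /(_ al0 qb0) [].
Qed.
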